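(* Let $n$ be a positive integer. The class $\mathbf{SUB}_n$ of all lattices $L$ that can be embedded into $\mathbf{Co}(P)$ for a poset $P$ of length at most $n$ is a finitely based variety, defined by the identities (S), (U), (B), (H$_n$), and (H$_{k,n+1-k}$) for $1<k<n$.
   Context: For a poset $(P,\trianglelefteq)$, a subset $X\subseteq P$ is order-convex if $x\trianglelefteq z\trianglelefteq y$ and $\{x,y\}\subseteq X$ imply $z\in X$. $\mathbf{Co}(P)$ is the lattice of all order-convex subsets of $P$ under inclusion. The length of $P$ is the supremum of $|C|-1$ over finite subchains $C$ of $P$. A variety is finitely based if it is the class of all lattices satisfying some finite set of lattice identities. Identity (S), where $b'=b\wedge(b_0\vee b_1)$: $$a\wedge(b'\vee c)=(a\wedge b')\vee\bigvee_{i<2}\Bigl(a\wedge(b_i\vee c)\wedge\bigl((b'\wedge(a\vee b_i))\vee c\bigr)\Bigr).$$ Identity (U): $$x\wedge(x_0\vee x_1)\wedge(x_1\vee x_2)\wedge(x_0\vee x_2)=(x\wedge x_0\wedge(x_1\vee x_2))\vee(x\wedge x_1\wedge(x_0\vee x_2))\vee(x\wedge x_2\wedge(x_0\vee x_1)).$$ Identity (B): $$x\wedge(a_0\vee a_1)\wedge(b_0\vee b_1)=\bigvee_{i<2}\Bigl(\bigl(x\wedge a_i\wedge(b_0\vee b_1)\bigr)\vee\bigl(x\wedge b_i\wedge(a_0\vee a_1)\bigr)\Bigr)\vee\bigvee_{i<2}\bigl(x\wedge(a_0\vee a_1)\wedge(b_0\vee b_1)\wedge(a_0\vee b_i)\wedge(a_1\vee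 b_{1-i})\bigr).$$ Polynomials: for a positive integer $n$, with variables $\vec x=\langle x_0,\dots,x_n\rangle$ and $\vec x'=\langle x'_1,\dots,x'_n\rangle$, define inductively $U_{n,n}=x_n$; $U_{i,n}=x_i\wedge(U_{i+1,n}\vee x'_{i+1})$ for $0\le i\le n-1$; $V_{i,i,n}=(x_i\wedge U_{i+1,n})\vee(x_i\wedge x'_{i+1})$ for $0\le i\le n-1$; $V_{i,j,n}=x_j\wedge(V_{i,j+1,n}\vee x'_{j+1})$ for $0\le j<i\le n-1$; $W_{i,i,n}=x_i\wedge(x'_{i+1}\vee x'_{i+2})\wedge\bigl((U_{i+1,n}\wedge(x_i\vee x'_{i+2}))\vee x'_{i+1}\bigr)$ for $0\le i\le n-2$; $W_{i,j,n}=x_j\wedge(W_{i,j+1,n}\vee x'_{j+1})$ for $0\le j<i\le n-2$. Put $U_n=U_{0,n}$, $V_{i,n}=V_{i,0,n}$ ($0\le i\le n-1$), $W_{i,n}=W_{i,0,n}$ ($0\le i\le n-2$). Identity (H$_n$): $U_n=\bigvee_{0\le i\le n-1}V_{i,n}\vee\bigvee_{0\le i\le n-2}W_{i,n}$ (for $n=1$ the right-hand side is just $V_{0,1}$; in general, joins over an empty index set are omitted). Identity (H$_{m,n}$), for positive integers $m,n$, with variables $t$, $x_i,x'_i$ ($1\le i\le m$), $y_j,y'_j$ ($1\le j\le n$), where $x_0=y_0=t$ (joins over an empty index set are omitted): $$\begin{aligned}U_m(\vec x,\vec x')\wedge U_n(\vec y,\vec y')=&\bigvee_{0\le i\le m-1}\bigl(V_{i,m}(\vec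 x,\vec x')\wedge U_n(\vec y,\vec y')\bigr)\vee\bigvee_{0\le i\le m-2}\bigl(W_{i,m}(\vec x,\vec x')\wedge U_n(\vec y,\vec y')\bigr)\\&\vee\bigvee_{0\le j\le n-1}\bigl(U_m(\vec x,\vec x')\wedge V_{j,n}(\vec y,\vec y')\bigr)\vee\bigvee_{0\le j\le n-2}\bigl(U_m(\vec x,\vec x')\wedge W_{j,n}(\vec y,\vec y')\bigr)\\&\vee\bigl(U_m(\vec x,\vec x')\wedge U_n(\vec y,\vec y')\wedge(x_1\vee y'_1)\wedge(x'_1\vee y_1)\bigr).\end{aligned}$$ *)

(* Defs.v *)
From HB Require Import structures.
From mathcomp Require Import all_boot all_order.
From mathcomp Require Import mathcomp_extra boolp classical_sets.

Set Implicit Arguments.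
Unset Strict Implicit.
Unset Printing Implicit Defensive.

Import Order.TTheory.

Local Open Scope classical_set_scope.
Local Open Scope order_scope.

Definition order_convex d (P : porderType d) (X : set P) : Prop :=
  forall x y z : P, X x -> X y -> x <= z -> z <= y -> X z.

Record Co d (P : porderType d) := MkCo {
  co_set : set P;
  co_setP : `[< order_convex co_set >]
}.

HB.instance Definition _ d (P : porderType d) :=
  [isSub for @co_set d P].
HB.instance Definition _ d (P : porderType d) := [Choice of Co P by <:].

Fact co_display : Order.disp_t. Proof. exact: Order.Disp tt tt. Qed.

Definition co_le d (P : porderType d) (A B : Co P) : bool :=
  `[< co_set A `<=` co_set B >].

Lemma co_le_refl d (P : porderType d) : reflexive (@co_le d P).
Proof. by move=> A; apply/asboolP. Qed.

Lemma co_le_anti d (P : porderType d) : antisymmetric (@co_le d P).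
Proof.
move=> A B /andP[/asboolP AB /asboolP BA]; apply: val_inj => /=.
by apply/seteqP.
Qed.

Lemma co_le_trans d (P : porderType d) : transitive (@co_le d P).
Proof.
move=> B A C /asboolP AB /asboolP BC; apply/asboolP.
exact: subset_trans BC.
Qed.

HB.instance Definition _ d (P : porderType d) :=
  Order.Le_isPOrder.Build co_display (Co P)
    (@co_le_refl d P) (@co_le_anti d P) (@co_le_trans d P).

Lemma co_leE d (P : porderType d) (A B : Co P) :
  (A <= B) = `[< co_set A `<=` co_set B >].
Proof. by []. Qed.

Definition convex_hull d (P : porderType d) (X : set P) : set P :=
  [set z | exists x y, [/\ X x, X y, x <= z & z <= y]].

Lemma convex_hull_convex d (P : porderType d) (X : set P) :
  order_convex (convex_hull X).
Proof.
move=> u v z [x [_ [Xx _ xu _]]] [_ [y [_ Xy _ vy]]] uz zv.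
by exists x, y; split=> //; [exact: le_trans uz|exact: le_trans vy].
Qed.

Lemma co_meet_convex d (P : porderType d) (A B : Co P) :
  order_convex (co_set A `&` co_set B)%classic.
Proof.
have /asboolP cA := co_setP A; have /asboolP cB := co_setP B.
move=> x y z [Ax Bx] [Ay By] xz zy.
by split; [exact: (cA x y)|exact: (cB x y)].
Qed.

Definition co_meet d (P : porderType d) (A B : Co P) : Co P :=
  MkCo (asboolT (@co_meet_convex d P A B)).

Definition co_join d (P : porderType d) (A B : Co P) : Co P :=
  MkCo (asboolT (@convex_hull_convex d P (co_set A `|` co_set B)%classic)).

Lemma co_meetP d (P : porderType d) (A B C : Co P) :
  (A <= co_meet B C) = (A <= B) && (A <= C).
Proof.
rewrite !co_leE; apply/asboolP/andP => [ABC|[/asboolP AB /asboolP AC] x Ax].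
  by split; apply/asboolP => x /ABC[].
by split; [exact: AB|exact: AC].
Qed.

Lemma co_joinP d (P : porderType d) (A B C : Co P) :
  (co_join A B <= C) = (A <= C) && (B <= C).
Proof.
rewrite !co_leE; apply/asboolP/andP => [ABC|[/asboolP AC /asboolP BC]].
  by split; apply/asboolP => x Xx; apply: ABC; exists x, x;
    split=> //; (left + right).
have /asboolP cC := co_setP C => z [x [y [Xx Xy]]].
by apply: cC; [case: Xx => [/AC|/BC]|case: Xy => [/AC|/BC]].
Qed.

HB.instance Definition _ d (P : porderType d) :=
  Order.POrder_MeetJoin_isLattice.Build co_display (Co P)
    (@co_meetP d P) (@co_joinP d P).

(* A finite subchain [C] is listed without repetition by [s]; [(size s).-1] is
   [|C| - 1], except that the empty chain counts for [0] instead of [-1], which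
   changes no upper bound [n : nat]. *)
Definition length_at_most (n : nat) d (P : porderType d) : Prop :=
  forall s : seq P, uniq s -> {in s &, forall x y, x >=< y} ->
  ((size s).-1 <= n)%N.

Inductive lterm : Type :=
| Var of nat
| Meet of lterm & lterm
| Join of lterm & lterm.

HB.instance Definition _ := gen_eqMixin lterm.

Declare Scope lterm_scope.
Delimit Scope lterm_scope with lterm.
Bind Scope lterm_scope with lterm.
Notation "s `&` t" := (Meet s t) : lterm_scope.
Notation "s `|` t" := (Join s t) : lterm_scope.

(* Used only for nonempty sequences; the value on [[::]] is arbitrary. *)
Definition joins (s : seq lterm) : lterm :=
  if s is t :: s' then foldl Join t s' else Var 0.

Fixpoint leval d (L : latticeType d) (v : nat -> L) (t : lterm) : L :=
  match t with
  | Var i => v i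
  | Meet t1 t2 => leval v t1 `&` leval v t2
  | Join t1 t2 => leval v t1 `|` leval v t2
  end.

Notation identity := (lterm * lterm)%type (only parsing).

Definition satisfies d (L : latticeType d) (e : identity) : Prop :=
  forall v : nat -> L, leval v e.1 = leval v e.2.

Definition lattice_class : Type := forall d, latticeType d -> Prop.

Definition defined_by (K : lattice_class) (E : seq identity) : Prop :=
  forall d (L : latticeType d), K d L <-> forall e, e \in E -> satisfies L e.

Definition finitely_based_variety (K : lattice_class) : Prop :=
  exists E : seq identity, defined_by K E.

Definition SUB (n : nat) : lattice_class := fun d (L : latticeType d) =>
  exists (dP : Order.disp_t) (P : porderType dP) (f : {lmorphism L -> Co P}),
    length_at_most n P /\ injective f.

Local Open Scope lterm_scope.

Definition idS : identity :=
  let a := Var 0 in let b := Var 1 in let b0 := Var 2 in let b1 := Var 3 in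
  let c := Var 4 in
  let b' := b `&` (b0 `|` b1) in
  let term bi := a `&` (bi `|` c) `&` ((b' `&` (a `|` bi)) `|` c) in
  (a `&` (b' `|` c), (a `&` b') `|` (term b0 `|` term b1)).

Definition idU : identity :=
  let x := Var 0 in let x0 := Var 1 in let x1 := Var 2 in let x2 := Var 3 in
  (x `&` (x0 `|` x1) `&` (x1 `|` x2) `&` (x0 `|` x2),
   (x `&` x0 `&` (x1 `|` x2)) `|` (x `&` x1 `&` (x0 `|` x2))
   `|` (x `&` x2 `&` (x0 `|` x1))).

Definition idB : identity :=
  let x := Var 0 in let a0 := Var 1 in let a1 := Var 2 in
  let b0 := Var 3 in let b1 := Var 4 in
  let m := x `&` (a0 `|` a1) `&` (b0 `|` b1) in
  (m,
   joins [:: (x `&` a0 `&` (b0 `|` b1)) `|` (x `&` b0 `&` (a0 `|` a1));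
             (x `&` a1 `&` (b0 `|` b1)) `|` (x `&` b1 `&` (a0 `|` a1));
             m `&` (a0 `|` b0) `&` (a1 `|` b1);
             m `&` (a0 `|` b1) `&` (a1 `|` b0)]).

(* [nest x x' e j k] is
   x_j /\ (x_{j+1} /\ (... (e \/ x'_{j+k}) ...) \/ x'_{j+1}), with [k] nested
   steps.  The recursions U_{i,n} (towards [i = n]), V_{i,j,n} and W_{i,j,n}
   (towards [j = i]) are all of this form. *)
Fixpoint nest (x x' : nat -> lterm) (e : lterm) (j k : nat) : lterm :=
  if k is k'.+1 then x j `&` (nest x x' e j.+1 k' `|` x' j.+1) else e.

(* U_{i,n}, for i <= n *)
Definition polU_ (x x' : nat -> lterm) (i n : nat) : lterm :=
  nest x x' (x n) i (n - i).

(* V_{i,j,n}, for j <= i <= n - 1 *)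
Definition polV_ (x x' : nat -> lterm) (i j n : nat) : lterm :=
  nest x x' ((x i `&` polU_ x x' i.+1 n) `|` (x i `&` x' i.+1)) j (i - j).

(* W_{i,j,n}, for j <= i <= n - 2 *)
Definition polW_ (x x' : nat -> lterm) (i j n : nat) : lterm :=
  nest x x' (x i `&` (x' i.+1 `|` x' i.+2)
             `&` ((polU_ x x' i.+1 n `&` (x i `|` x' i.+2)) `|` x' i.+1))
    j (i - j).

Definition polU x x' n := polU_ x x' 0 n.
Definition polV x x' i n := polV_ x x' i 0 n.
Definition polW x x' i n := polW_ x x' i 0 n.

Definition idH (n : nat) : identity :=
  let x i := Var (2 * i) in let x' i := Var (2 * i + 1) in
  (polU x x' n,
   joins ([seq polV x x' i n | i <- iota 0 n]
       ++ [seq polW x x' i n | i <- iota 0 (n - 1)])).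

(* [Var 0] is the common value t of x_0 and y_0; the variables x_i, y_i, x'_i
   and y'_i with i > 0 are pairwise distinct. *)
Definition idH2 (m n : nat) : identity :=
  let x i := Var (4 * i) in let x' i := Var (4 * i + 1) in
  let y i := if i is 0 then Var 0 else Var (4 * i + 2) in
  let y' i := Var (4 * i + 3) in
  let Ux := polU x x' m in let Uy := polU y y' n in
  (Ux `&` Uy,
   joins ([seq polV x x' i m `&` Uy | i <- iota 0 m]
       ++ [seq polW x x' i m `&` Uy | i <- iota 0 (m - 1)]
       ++ [seq Ux `&` polV y y' j n | j <- iota 0 n]
       ++ [seq Ux `&` polW y y' j n | j <- iota 0 (n - 1)]
       ++ [:: Ux `&` Uy `&` (x 1 `|` y' 1) `&` (x' 1 `|` y 1)])).

(* [index_iota 2 n] lists the [k] with 1 < k < n. *)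
Definition SUB_identities (n : nat) : seq identity :=
  [:: idS; idU; idB; idH n] ++ [seq idH2 k (n + 1 - k) | k <- index_iota 2 n].

(* Main.v *)
Require Import Defs.
From HB Require Import structures.
From mathcomp Require Import all_boot all_order zify.
From mathcomp Require Import boolp classical_sets.

Set Implicit Arguments.
Unset Strict Implicit.
Unset Printing Implicit Defensive.

Import Order.TTheory.

(** The theorem has an elementary half and a representation half.

    Necessity. A point of [P] lies in a join of convex sets iff some element
    of one of the two sets lies below it and some element of one of them lies
    above it.  Read pointwise, (S), (U) and (B) thus become statements about
    which sets occur below and above a point ([co_idS], [co_idU], [co_idB]).
    Following a point of [U_n] through the nested joins that define [U_n]
    produces points [p_0, p_1, ..., p_n], each strictly between its successor
    and an element of the next primed set.  As soon as a point lies in one of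
    the two joined sets itself, or the direction turns, [p_0] is in some [V_i]
    or [W_i].  Otherwise the [p_i] and the primed element next to [p_0] form a
    chain of [n + 2] elements ([polU_flanked]).  In the same way, a point that
    refutes (H_{m,n}) starts two chains in opposite directions, of [m] and [n]
    steps.

    Sufficiency. [L] embeds into the lattice of its filters under reverse
    inclusion, which satisfies the same identities ([filter_satisfies]); there
    Zorn's lemma provides enough join-irreducible elements
    ([filter_ji_separation]) and makes every inequality [p <= a \/ b], with
    [p] join-irreducible and below neither [a] nor [b], shrink to a minimal
    one [p <= x \/ y], called a cover of [p] ([cover_exists]).  At a
    join-irreducible element each identity yields one of its joinands
    ([jiS], [jiU], [jiB]).  (U) and (B) split the elements occurring in the
    covers of [p] into two sides such that [p] is below the join of any two
    elements of opposite sides.  (S) relates consecutive covers: if [(x, y)]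
    is a cover of [q] and [(z, w)] a cover of [x], then exactly one of [z, w]
    lies beyond [x] as seen from [q], that is, [x] is between [q] and it, and
    [q] is between it and [y] ([cover_beyond], [cover_polarity]).

    Unfold covers into trees.  A node is a path of successive covers, every
    edge of which is directed up or down: edges towards opposite sides get
    opposite directions, and an edge keeps the direction of the preceding one
    iff it leads beyond it.  The order generated by the edges is the poset
    sought, and [a] is sent to the set of all nodes whose label, a
    join-irreducible element, is below [a].  A join is preserved since each
    cover of a label provides a child below and a child above the node
    ([co_underU]).  An interval of the poset is a path of the tree, going from
    its vertex nearest to the root down on one side and up on the other.  Both
    halves are tracks, sequences of covers each leading beyond the previous
    one, and labels along such a path are below the join of the labels of its
    ends ([track_hull], [tracks_hull], [path_hull]); so the sets of nodes are
    convex.  Finally, a track of length [n] refutes (H_n), and opposite tracks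
    of lengths [k] and [n + 1 - k] refute (H_{k,n+1-k}) ([idH_track],
    [idH2_tracks]), so that no chain of nodes has more than [n + 1] elements
    ([node_length]). *)

(** * The polynomials U, V and W *)
Section Terms.
Local Open Scope order_scope.
Variables (d : Order.disp_t) (L : latticeType d).
Implicit Types (v : nat -> L) (t e : lterm) (x : nat -> lterm).

Lemma joins_ub v t l : t \in l -> leval v t <= leval v (joins l).
Proof.
case: l => [|t0 l] //=; elim: l t0 t => [|t1 l IHl] t0 t /=.
  by rewrite inE => /eqP->.
rewrite 2!inE orbA => /orP[t01|tl].
  apply: le_trans (IHl (Join t0 t1) _ (mem_head _ _)) => /=.
  by case/orP: t01 => /eqP->; rewrite (leUl, leUr).
by apply: IHl; rewrite inE tl orbT.
Qed.

Lemma joins_lub v l (a : L) :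
  l != [::] -> (forall t, t \in l -> leval v t <= a) ->
  leval v (joins l) <= a.
Proof.
case: l => [|t0 l] //= _; elim: l t0 => [|t1 l IHl] t0 /= la.
  by apply: la; rewrite inE.
apply: IHl => t; rewrite inE => /orP[/eqP->|tl] /=.
  by rewrite leUx !la // !inE eqxx ?orbT.
by apply: la; rewrite !inE tl !orbT.
Qed.

Lemma nest_cat x x' e j k l :
  nest x x' e j (k + l) = nest x x' (nest x x' e (j + k) l) j k.
Proof.
elim: k j => [|k IHk] j /=; first by rewrite addn0.
by rewrite IHk addSnnS.
Qed.

Lemma nest_le v x x' e e' j k :
  leval v e <= leval v e' ->
  leval v (nest x x' e j k) <= leval v (nest x x' e' j k).
Proof.
by move=> ee'; elim: k j => [|k IHk] j //=; apply: leI2 => //; apply: leU2.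
Qed.

Lemma polU_nest x x' i j n :
  (j <= i <= n)%N -> polU_ x x' j n = nest x x' (polU_ x x' i n) j (i - j).
Proof.
case/andP=> ji jn; rewrite /polU_.
have -> : (n - j = (i - j) + (n - i))%N by rewrite addnC addnBA // subnK.
by rewrite nest_cat subnKC.
Qed.

Lemma polU_step x x' j n :
  (j < n)%N ->
  polU_ x x' j n = Meet (x j) (Join (polU_ x x' j.+1 n) (x' j.+1)).
Proof. by move=> jn; rewrite /polU_ -(subnSK jn). Qed.

Lemma polV_step x x' i j n :
  (j < i)%N ->
  polV_ x x' i j n = Meet (x j) (Join (polV_ x x' i j.+1 n) (x' j.+1)).
Proof. by move=> ji; rewrite /polV_ -(subnSK ji). Qed.

Lemma polW_step x x' i j n :
  (j < i)%N ->
  polW_ x x' i j n = Meet (x j) (Join (polW_ x x' i j.+1 n) (x' j.+1)).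
Proof. by move=> ji; rewrite /polW_ -(subnSK ji). Qed.

Lemma polV_last x x' i n : polV_ x x' i i n =
  Join (Meet (x i) (polU_ x x' i.+1 n)) (Meet (x i) (x' i.+1)).
Proof. by rewrite /polV_ subnn. Qed.

Lemma polW_last x x' i n : polW_ x x' i i n =
  Meet (Meet (x i) (Join (x' i.+1) (x' i.+2)))
    (Join (Meet (polU_ x x' i.+1 n) (Join (x i) (x' i.+2))) (x' i.+1)).
Proof. by rewrite /polW_ subnn. Qed.

Lemma polV_le v x x' i n :
  (i < n)%N -> leval v (polV x x' i n) <= leval v (polU x x' n).
Proof.
move=> lt_in; rewrite /polU (@polU_nest x x' i) ?(ltnW lt_in) //; apply: nest_le.
by rewrite (@polU_step _ _ i) //= leUx !leI2 ?leUl ?leUr.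
Qed.

Lemma polW_le v x x' i n :
  (i < n)%N -> leval v (polW x x' i n) <= leval v (polU x x' n).
Proof.
move=> lt_in; rewrite /polU (@polU_nest x x' i) ?(ltnW lt_in) //; apply: nest_le.
by rewrite (@polU_step _ _ i) //= -meetA leI2 // leIxr // leU2 // leIl.
Qed.

End Terms.

(** * The identities in lattices of convex sets *)
Section CoIdentities.
Local Open Scope order_scope.
Variables (d : Order.disp_t) (P : porderType d).
Implicit Types (A B C : Co P) (z : P) (v : nat -> Co P).

Definition below A z := exists2 u, co_set A u & u <= z.
Definition above A z := exists2 u, co_set A u & z <= u.

(** Convexity turns membership into a conjunction of two monotone conditions;
    with [co_joinE], pointwise inclusions between polynomials without nested
    joins become propositional tautologies. *)
Lemma co_memE A z : co_set A z <-> below A z /\ above A z.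
Proof.
split=> [Az|[[u Au uz] [w Aw zw]]]; first by split; exists z.
by have /asboolP cA := co_setP A; exact: (cA u w z).
Qed.

Lemma co_meetE A B z : co_set (A `&` B) z <-> co_set A z /\ co_set B z.
Proof. by []. Qed.

Lemma co_joinE A B z : co_set (A `|` B) z <->
  (below A z \/ below B z) /\ (above A z \/ above B z).
Proof.
split=> [[u [w [Xu Xw uz zw]]]|[lo hi]].
  by split; [case: Xu => ?; [left|right]; exists u
            |case: Xw => ?; [left|right]; exists w].
have [u Xu uz] : exists2 u, co_set A u \/ co_set B u & u <= z.
  by case: lo => -[u Xu uz]; exists u; tauto.
have [w Xw zw] : exists2 w, co_set A w \/ co_set B w & z <= w.
  by case: hi => -[w Xw zw]; exists w; tauto.
by exists u, w.
Qed.

Lemma co_leP A B : (forall z, co_set A z -> co_set B z) -> A <= B.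
Proof. by move=> AB; rewrite co_leE; apply/asboolP. Qed.

Lemma co_subP A B z : A <= B -> co_set A z -> co_set B z.
Proof. by rewrite co_leE => /asboolP; apply. Qed.

Lemma co_joinl A B z : co_set A z -> co_set (A `|` B) z.
Proof. by apply: co_subP; exact: leUl. Qed.

Lemma co_joinr A B z : co_set B z -> co_set (A `|` B) z.
Proof. by apply: co_subP; exact: leUr. Qed.

(** If [z] in [a] is between [u] in [b'] and an element of [c], then [u] is in
    [b0 \/ b1], so some [b_i] has an element on the far side of [u] from [z].
    That element makes [z] a member of [b_i \/ c] and [u] one of
    [a \/ b_i]. *)
Lemma co_idS : satisfies (Co P) idS.
Proof.
move=> v /=; set a := v 0; set b := v 1; set b0 := v 2; set b1 := v 3.
set c := v 4; set b' := b `&` (b0 `|` b1).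
apply/le_anti/andP; split; last first.
  have le1 bi : a `&` (bi `|` c) `&` (b' `&` (a `|` bi) `|` c) <= a `&` (b' `|` c).
    by apply: leI2; [exact: leIl|apply: leU2 => //; exact: leIl].
  by rewrite !leUx !le1 leI2 ?leUl.
apply: co_leP => z /co_meetE[az zbc].
pose term (bi : Co P) := a `&` (bi `|` c) `&` ((b' `&` (a `|` bi)) `|` c).
have termE bi : co_set (term bi) z ->
    (bi = b0 \/ bi = b1) ->
    co_set ((a `&` b') `|` (term b0 `|` term b1)) z.
  move=> Tz bi01; apply: co_subP Tz; rewrite lexU2 // orbC lexU2 //.
  by case: bi01 => ->; rewrite lexx ?orbT.
have ba bi : below bi z -> above c z ->
    (exists u, [/\ co_set b' u, u <= z & below bi u]) -> co_set (term bi) z.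
  move=> biz cz [u [b'u uz biu]]; split; first by split=> //; apply/co_joinE; tauto.
  apply/co_joinE; split; [left|by right].
  by exists u => //; split=> //; apply/co_joinE; split; [right|left; exists z].
have ab bi : above bi z -> below c z ->
    (exists u, [/\ co_set b' u, z <= u & above bi u]) -> co_set (term bi) z.
  move=> biz cz [u [b'u uz biu]]; split; first by split=> //; apply/co_joinE; tauto.
  apply/co_joinE; split; [by right|left].
  by exists u => //; split=> //; apply/co_joinE; split; [left; exists z|right].
case/co_joinE: zbc => -[lb|lc] [hb|hc].
- by apply/(@co_subP (a `&` b')); rewrite ?leUl //; split=> //; apply/co_memE.
- have [u b'u uz] := lb; have [_ /co_joinE[ub _]] := b'u.
  by case: ub => bu; [apply: (termE b0)|apply: (termE b1)];
     (try tauto); apply: ba => //; (try by exists u);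
     case: bu => w bw wu; exists w => //; exact: le_trans uz.
- have [u b'u uz] := hb; have [_ /co_joinE[_ ub]] := b'u.
  by case: ub => bu; [apply: (termE b0)|apply: (termE b1)];
     (try tauto); apply: ab => //; (try by exists u);
     case: bu => w bw wu; exists w => //; exact: le_trans wu.
- by apply: (termE b0); [|by left]; split; [split|]=> //; apply/co_joinE; tauto.
Qed.

(** Outside [x0], [x1], [x2], the point [z] has elements of each [x_i] on at
    most one side; two of the three sets would share that side, and [z] would
    not be in their join. *)
Lemma co_idU : satisfies (Co P) idU.
Proof.
move=> v /=; set x := v 0; set x0 := v 1; set x1 := v 2; set x2 := v 3.
apply/le_anti/andP; split; last first.
  rewrite !leUx -andbA; apply/and3P; split; apply: co_leP => z;
  by rewrite !co_meetE !co_joinE !co_memE; tauto.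
apply: co_leP => z [[[xz /co_joinE z01] /co_joinE z12] /co_joinE z02].
have [z0|[z1|z2]] : co_set x0 z \/ co_set x1 z \/ co_set x2 z.
  by rewrite !co_memE; tauto.
- apply: (@co_subP (x `&` x0 `&` (x1 `|` x2))); first by rewrite -joinA leUl.
  by split=> //; apply/co_joinE.
- apply: (@co_subP (x `&` x1 `&` (x0 `|` x2))).
    by rewrite -joinA lexU2 // leUl orbT.
  by split=> //; apply/co_joinE.
- apply: (@co_subP (x `&` x2 `&` (x0 `|` x1))); first by rewrite leUr.
  by split=> //; apply/co_joinE.
Qed.

Lemma co_idB : satisfies (Co P) idB.
Proof.
move=> v; apply/le_anti/andP; split; last first.
  apply: joins_lub => // t; rewrite !in_cons in_nil orbF => /or4P[] /eqP-> /=;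
  rewrite ?leUx; [apply/andP; split|apply/andP; split| |];
  apply: co_leP => z;
  by rewrite !co_meetE !co_joinE !co_memE; tauto.
apply: co_leP => z.
set x := v 0; set a0 := v 1; set a1 := v 2; set b0 := v 3; set b1 := v 4.
pose m := x `&` (a0 `|` a1) `&` (b0 `|` b1); rewrite -[leval v _]/m => mz.
have [[xz /co_joinE za] /co_joinE zb] := mz.
have : (co_set a0 z \/ co_set b0 z) \/ (co_set a1 z \/ co_set b1 z) \/
   (co_set (a0 `|` b0) z /\ co_set (a1 `|` b1) z) \/
   (co_set (a0 `|` b1) z /\ co_set (a1 `|` b0) z).
  by rewrite !co_joinE !co_memE; tauto.
move/co_joinE: za => za; move/co_joinE: zb => zb.
rewrite -[leval v _]/(((x `&` a0 `&` (b0 `|` b1)) `|` (x `&` b0 `&` (a0 `|` a1)))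
  `|` ((x `&` a1 `&` (b0 `|` b1)) `|` (x `&` b1 `&` (a0 `|` a1)))
  `|` (m `&` (a0 `|` b0) `&` (a1 `|` b1)) `|` (m `&` (a0 `|` b1) `&` (a1 `|` b0))).
case=> [[]|[[]|[]]] => [z0|z0|z1|z1|[zA zB]|[zA zB]].
- by do 4!apply: co_joinl.
- by do 3!apply: co_joinl; apply: co_joinr.
- by do 2!apply: co_joinl; apply: co_joinr; apply: co_joinl.
- by do 2!apply: co_joinl; apply: co_joinr; apply: co_joinr.
- by apply: co_joinl; apply: co_joinr.
- by apply: co_joinr.
Qed.

(** Strict order read upwards or downwards, so that each argument on chains is
    made once for both directions. *)
Definition dir (b : bool) : rel P := if b then <%O else >%O.

Lemma join_cases A B z : co_set (A `|` B) z ->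
  [\/ co_set A z, co_set B z | exists b u w,
    [/\ co_set A u, co_set B w, dir b z u & dir (~~ b) z w]].
Proof.
case: (pselect (co_set A z)) => [Az _|nAz]; first by constructor 1.
case: (pselect (co_set B z)) => [Bz _|nBz]; first by constructor 2.
have neq X u : co_set X u -> ~ co_set X z -> u != z.
  by move=> Xu nXz; apply: contra_notN nXz => /eqP <-.
move=> zAB; constructor 3; move: zAB nAz nBz.
case/co_joinE=> -[] -[u Xu uz] [] [w Yw zw] nAz nBz.
- by case: nAz; apply/co_memE; split; [exists u|exists w].
- by exists false, u, w; rewrite /= !lt_def zw uz (neq B) // eq_sym (neq A).
- by exists true, w, u; rewrite /= !lt_def zw uz (neq A) // eq_sym (neq B).
- by case: nBz; apply/co_memE; split; [exists u|exists w].
Qed.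

Lemma join_dir A B b z u w :
  co_set A u -> co_set B w -> dir b z u -> dir (~~ b) z w -> co_set (A `|` B) z.
Proof.
move=> Au Bw zu zw; apply/co_joinE; case: b zu zw => /= zu zw.
  by split; [right; exists w|left; exists u] => //; exact: ltW.
by split; [left; exists u|right; exists w] => //; exact: ltW.
Qed.

Section Polynomials.
Variables (v : nat -> Co P) (x x' : nat -> lterm) (n : nat).
Local Notation "z \inT t" := (co_set (leval v t) z) (at level 70).

(** A strict chain that leaves [z] in direction [b] through [x_{j+1}] and has
    as many steps as [U_{j,n}] has nested joins, together with an element of
    [x'_{j+1}] on the other side of [z]. *)
Definition flanked (b : bool) (j : nat) (z : P) : Prop :=
  exists u s w, [/\ u \inT x j.+1, path (dir b) z (u :: s),
    size s = (n - j.+1)%N, w \inT x' j.+1 & dir (~~ b) z w].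

Lemma polU_step_cases j z : (j < n)%N -> z \inT polU_ x x' j n ->
  z \inT polV_ x x' j j n \/ exists b u w,
    [/\ z \inT x j, u \inT polU_ x x' j.+1 n, w \inT x' j.+1,
        dir b z u & dir (~~ b) z w].
Proof.
move=> jn; rewrite polU_step //= => -[xz /join_cases].
rewrite polV_last; case=> [Uz|x'z|[b [u [w [Uu x'w zu zw]]]]].
- by left; apply: co_joinl.
- by left; apply: co_joinr.
- by right; exists b, u, w.
Qed.

(** The next point [u] of the chain is in [U_{j+1,n}].  If [u] itself is in a
    [V] or [W] term, the nesting carries it to [z]; if [u] starts a chain in
    the same direction, [z] extends it; if the direction turns at [u], then
    [z] is in [W_{j,j,n}]. *)
Lemma polU_flanked j z : (j < n)%N -> z \inT polU_ x x' j n ->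
  [\/ exists2 i, (j <= i < n)%N & z \inT polV_ x x' i j n,
      exists2 i, (j <= i < n - 1)%N & z \inT polW_ x x' i j n
    | exists b, flanked b j z].
Proof.
move=> jn; have [k nE] : exists k, n = (j + k.+1)%N.
  by exists (n - j.+1)%N; rewrite addnS -addSn subnKC.
elim: k j nE z jn => [|k IHk] j nE z jn /(polU_step_cases jn);
  case=> [Vz|[b [u [w [xz Uu x'w zu zw]]]]];
  try by constructor 1; exists j; rewrite ?leqnn.
  have jE : j.+1 = n by rewrite nE addn1.
  constructor 3; exists b, u, [::], w; rewrite /= zu jE subnn; split=> //.
    by move: Uu; rewrite jE /polU_ subnn.
  by rewrite -jE.
rewrite -addSnnS in nE; have j1n : (j.+1 < n)%N by rewrite nE addnS ltnS leq_addr.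
have mkjoin t : u \inT t -> z \inT Meet (x j) (Join t (x' j.+1)).
  by move=> tu; split=> //; apply: join_dir x'w zu zw.
case: (IHk j.+1 nE u j1n Uu) => [[i /andP[ji jn'] Vu]|[i /andP[ji jn'] Wu]|].
- constructor 1; exists i; first by rewrite jn' ltnW.
  by rewrite polV_step //; exact: mkjoin.
- constructor 2; exists i; first by rewrite jn' ltnW.
  by rewrite polW_step //; exact: mkjoin.
case=> b' [u' [s [w' [xu' pathu' szs x'w' uw']]]].
have xu : u \inT x j.+1 by move: Uu; rewrite polU_step //= => -[].
case: (eqVneq b' b) => [eb|nb].
  rewrite {b'}eb in pathu' uw'.
  constructor 3; exists b, u, (u' :: s), w; split=> //.
    by rewrite /= zu.
  by rewrite /= szs subnSK.
(* The chain turns back at [u], so that [z] lies strictly between [u] and the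
   witness [w] on one side and [u] between [z] and [w'] on the other. *)
have {nb} eb : b' = ~~ b by case: b' b nb {pathu' uw' zu zw} => [] [].
rewrite {b'}eb negbK in uw' pathu'.
have zw' : dir b z w'.
  by case: b zu uw' {zw pathu'} => /= zu uw'; [exact: lt_trans uw'|exact: lt_trans zu].
have uz : dir (~~ b) u z by case: b zu {zw pathu' uw' zw'}.
constructor 2; exists j; first by rewrite leqnn ltn_subRL add1n.
rewrite polW_last; split; first split=> //.
  by apply: join_dir x'w x'w' zw _; rewrite negbK.
apply: (join_dir (u := u) _ x'w zu zw); split=> //.
by apply: (join_dir (u := z) xz x'w' uz); rewrite negbK.
Qed.

End Polynomials.

Lemma size_up_down_paths N z s s' : length_at_most N P ->
  path (dir true) z s -> path (dir false) z s' -> (size s + size s' <= N)%N.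
Proof.
move=> PN zs zs'; have srt : sorted <%O (rev s' ++ z :: s).
  rewrite -cat_rcons -rev_cons.
  have : sorted <%O (rev (z :: s')) by rewrite rev_sorted.
  rewrite rev_cons; case E : (rcons _ _) => [|t r].
    by case: (rev s') E.
  rewrite /= cat_path => -> /=.
  suff -> : last t r = z by [].
  by rewrite -[LHS]/(last t (t :: r)) -E last_rcons.
have := PN _ (lt_sorted_uniq srt); rewrite size_cat size_rev /= addnS /= addnC.
apply=> a b /(nthP z)[i isz <-] /(nthP z)[j jsz <-].
have srt' := lt_sorted_ltn_nth z srt.
case: (ltngtP i j) => [ij|ij|->]; last exact: comparablexx.
  by apply: lt_comparable; rewrite srt'.
by apply: gt_comparable; rewrite srt'.
Qed.

Lemma size_opposite_paths N b z s s' : length_at_most N P ->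
  path (dir b) z s -> path (dir (~~ b)) z s' -> (size s + size s' <= N)%N.
Proof.
case: b => PN zs zs'; first exact: size_up_down_paths zs zs'.
by rewrite addnC; exact: size_up_down_paths zs' zs.
Qed.

Lemma co_idH n : (0 < n)%N -> length_at_most n P -> satisfies (Co P) (idH n).
Proof.
move=> n0 Pn v; rewrite /idH.
set x := fun i => Var (2 * i); set x' := fun i => Var (2 * i + 1).
apply/le_anti/andP; split.
  apply: co_leP => z /(polU_flanked n0).
  case=> [[i /andP[_ lt_in] Vz]|[i /andP[_ lt_in] Wz]|].
  - apply: (co_subP (joins_ub v (t := polV x x' i n) _) Vz).
    rewrite mem_cat; apply/orP; left.
    by apply: (map_f (fun i => polV x x' i n)); rewrite mem_iota.
  - apply: (co_subP (joins_ub v (t := polW x x' i n) _) Wz).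
    rewrite mem_cat; apply/orP; right.
    by apply: (map_f (fun i => polW x x' i n)); rewrite mem_iota.
  case=> b [u [s [w [_ zus szs _ zw]]]].
  have := @size_opposite_paths n b z (u :: s) [:: w] Pn zus.
  by rewrite /= zw szs subn1 prednK // addn1 ltnn => /(_ isT).
apply: joins_lub; first by case: n n0 {Pn}.
move=> t; rewrite mem_cat => /orP[] /mapP[i]; rewrite mem_iota => /andP[_ lt_in] ->.
  exact: polV_le.
by apply: polW_le; apply: leq_trans lt_in _; rewrite leq_subr.
Qed.

(** If both factors give chains through [z] with the same direction, then the
    first elements on either side of [z] put it in [x_1 \/ y'_1] and in
    [x'_1 \/ y_1]; chains with opposite directions add up to one that is too
    long. *)
Lemma co_idH2 m n N : (0 < m)%N -> (0 < n)%N -> (N < m + n)%N ->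
  length_at_most N P -> satisfies (Co P) (idH2 m n).
Proof.
move=> m0 n0 Nmn PN v; rewrite /idH2.
set x := fun i => Var (4 * i); set x' := fun i => Var (4 * i + 1).
set y := fun i => if i is 0 then _ else _; set y' := fun i => Var (4 * i + 3).
set l := _ ++ _.
have ltB1 i k : (i < 0 + (k - 1))%N -> (i < k)%N.
  by move=> h; apply: leq_trans h _; rewrite leq_subr.
apply/le_anti/andP; split; last first.
  apply: joins_lub; first by rewrite /l; case: (m) m0.
  move=> t; rewrite !mem_cat mem_seq1.
  case/orP=> [|/orP[|/orP[|/orP[|/eqP->]]]]; last by rewrite /= -!meetA leI2 // leIl.
  - by case/mapP=> i; rewrite mem_iota => /andP[_ im] ->; apply: leI2 => //;
    apply: polV_le.
  - by case/mapP=> i; rewrite mem_iota => /andP[_ im] ->; apply: leI2 => //;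
    apply: polW_le; exact: ltB1.
  - by case/mapP=> i; rewrite mem_iota => /andP[_ im] ->; apply: leI2 => //;
    apply: polV_le.
  - by case/mapP=> i; rewrite mem_iota => /andP[_ im] ->; apply: leI2 => //;
    apply: polW_le; exact: ltB1.
apply: co_leP => z [Uz U'z].
have inl t : t \in l -> co_set (leval v t) z -> co_set (leval v (joins l)) z.
  by move=> tl; apply: co_subP; exact: joins_ub.
have [[i ii Vz]|[i ii Wz]|[b [u [s [w [xu zus szs xw zw]]]]]] := polU_flanked m0 Uz.
- apply: (inl (polV x x' i m `&` polU y y' n)%lterm) => //.
  rewrite /l !mem_cat; apply/or3P; constructor 1.
  by apply: (map_f (fun i => Meet (polV x x' i m) _)); rewrite mem_iota.
- apply: (inl (polW x x' i m `&` polU y y' n)%lterm) => //.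
  rewrite /l !mem_cat; apply/or3P; constructor 2.
  by apply: (map_f (fun i => Meet (polW x x' i m) _)); rewrite mem_iota.
have [[i ii Vz]|[i ii Wz]|[b' [u' [s' [w' [xu' zus' szs' xw' zw']]]]]] :=
  polU_flanked n0 U'z.
- apply: (inl (polU x x' m `&` polV y y' i n)%lterm) => //.
  rewrite /l !mem_cat; apply/or4P; constructor 3.
  by apply: (map_f (fun i => Meet _ (polV y y' i n))); rewrite mem_iota.
- apply: (inl (polU x x' m `&` polW y y' i n)%lterm) => //.
  rewrite /l !mem_cat; apply/or4P; constructor 4; rewrite map_f ?mem_iota //.
case: (eqVneq b' b) => [eb|nb]; last first.
  have eb : b' = ~~ b by case: b' b nb {zus zus' zw zw'} => [] [].
  rewrite eb in zus'; have := size_opposite_paths PN zus zus'.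
  by rewrite /= szs szs' !subn1 !prednK // leqNgt Nmn.
rewrite {b'}eb in zw' zus'.
apply: (inl (polU x x' m `&` polU y y' n `&` (x 1 `|` y' 1) `&` (x' 1 `|` y 1))%lterm).
  by rewrite /l !mem_cat !inE eqxx !orbT.
case/andP: zus => zu _; case/andP: zus' => zu' _.
split; first split=> //; rewrite /leval -/leval.
  exact: join_dir zu zw'.
by apply: join_dir xw xu' zw _; rewrite negbK.
Qed.

End CoIdentities.

Section Pullback.
Local Open Scope order_scope.

Lemma leval_morph d (L : latticeType d) d' (M : latticeType d')
    (f : {lmorphism L -> M}) v t : leval (f \o v) t = f (leval v t).
Proof.
by elim: t => [i|s IHs t IHt|s IHs t IHt] //=;
   rewrite IHs IHt (omorphI, omorphU).
Qed.

(** Identities pass to sublattices. *)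
Lemma satisfies_embedding d (L : latticeType d) d' (M : latticeType d')
    (f : {lmorphism L -> M}) e :
  injective f -> satisfies M e -> satisfies L e.
Proof. by move=> f_inj Me v; apply: f_inj; rewrite -!leval_morph. Qed.

End Pullback.

Lemma SUB_satisfies n d (L : latticeType d) e :
  0 < n -> SUB n L -> e \in SUB_identities n -> satisfies L e.
Proof.
move=> n0 [dP [P [f [Pn f_inj]]]]; rewrite mem_cat !inE => He.
apply: (satisfies_embedding f_inj).
case/orP: He => [/or4P[] /eqP->|].
- exact: co_idS.
- exact: co_idU.
- exact: co_idB.
- exact: co_idH.
case/mapP=> k; rewrite mem_index_iota => /andP[k1 kn] ->.
apply: co_idH2 Pn; first exact: ltnW.
  by rewrite subn_gt0 addn1 ltnS ltnW.
by rewrite subnKC addn1 // ltnW // ltnW.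
Qed.

(** * The lattice of filters *)
Section Filters.
Local Open Scope order_scope.
Variables (d : Order.disp_t) (L : latticeType d).

Definition is_filter (F : set L) : Prop :=
  [/\ exists a, F a, forall a b, F a -> a <= b -> F b
    & forall a b, F a -> F b -> F (a `&` b)].

Record lfilter := MkFilter { fset : set L; filterP : `[< is_filter fset >] }.

HB.instance Definition _ := [isSub for fset].
HB.instance Definition _ := [Choice of lfilter by <:].

Implicit Types (F G H : lfilter) (v : nat -> lfilter).

Lemma filter_ex F : exists a, fset F a.
Proof. by have /asboolP[] := filterP F. Qed.

Lemma filter_up F a b : fset F a -> a <= b -> fset F b.
Proof. by have /asboolP[_ up _] := filterP F; exact: up. Qed.

Lemma filter_meet F a b : fset F a -> fset F b -> fset F (a `&` b).
Proof. by have /asboolP[_ _] := filterP F; apply. Qed.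

(** Reverse inclusion, so that the principal filters embed [L]. *)
Definition filter_le F G : bool := `[< fset G `<=` fset F >]%classic.

Fact filter_le_refl : reflexive filter_le.
Proof. by move=> F; apply/asboolP. Qed.

Fact filter_le_anti : antisymmetric filter_le.
Proof.
by move=> F G /andP[/asboolP FG /asboolP GF]; apply: val_inj; apply/seteqP.
Qed.

Fact filter_le_trans : transitive filter_le.
Proof.
by move=> F G H /asboolP FG /asboolP GH; apply/asboolP; exact: subset_trans FG.
Qed.

Fact filter_display : Order.disp_t. Proof. exact: Order.Disp tt tt. Qed.

HB.instance Definition _ := Order.Le_isPOrder.Build filter_display lfilter
  filter_le_refl filter_le_anti filter_le_trans.

Lemma filter_leP F G : (forall a, fset G a -> fset F a) <-> F <= G.
Proof. by split=> [GF|/asboolP //]; apply/asboolP. Qed.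

Fact filter_meet_subproof F G :
  is_filter [set c | exists a b, [/\ fset F a, fset G b & a `&` b <= c]].
Proof.
have [[a Fa] [b Gb]] := (filter_ex F, filter_ex G); split.
- by exists (a `&` b), a, b.
- by move=> s t [a' [b' [Fa' Gb' s']]] st; exists a', b'; split=> //; exact: le_trans st.
move=> s t [a1 [b1 [Fa1 Gb1 s1]]] [a2 [b2 [Fa2 Gb2 s2]]].
exists (a1 `&` a2), (b1 `&` b2); split; try exact: filter_meet.
by rewrite meetACA leI2.
Qed.

Fact filter_join_subproof F G : is_filter (fset F `&` fset G)%classic.
Proof.
have [[a Fa] [b Gb]] := (filter_ex F, filter_ex G); split.
- exists (a `|` b); split; [apply: filter_up Fa _|apply: filter_up Gb _];
  by rewrite (leUl, leUr).
- by move=> s t [Fs Gs] st; split; exact: filter_up st.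
- by move=> s t [Fs Gs] [Ft Gt]; split; exact: filter_meet.
Qed.

Definition meet_filter F G := MkFilter (asboolT (filter_meet_subproof F G)).
Definition join_filter F G := MkFilter (asboolT (filter_join_subproof F G)).

Fact meet_filterP F G H : (F <= meet_filter G H) = (F <= G) && (F <= H).
Proof.
apply/idP/andP => [/filter_leP FGH|[/filter_leP FG /filter_leP FH]].
  have [[a Ga] [b Hb]] := (filter_ex G, filter_ex H).
  split; apply/filter_leP => c Xc; apply: FGH.
    by exists c, b; rewrite leIl.
  by exists a, c; rewrite leIr.
apply/filter_leP => c [a [b [Ga Hb]]]; apply: filter_up.
by apply: filter_meet; [exact: FG|exact: FH].
Qed.

Fact join_filterP F G H : (join_filter F G <= H) = (F <= H) && (G <= H).
Proof.
apply/idP/andP => [/filter_leP FGH|[/filter_leP FH /filter_leP GH]].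
  by split; apply/filter_leP => c /FGH[].
by apply/filter_leP => c Hc; split; [exact: FH|exact: GH].
Qed.

HB.instance Definition _ :=
  Order.POrder_MeetJoin_isLattice.Build filter_display lfilter
    meet_filterP join_filterP.

Lemma fset_meetE F G c : fset (F `&` G) c <->
  exists a b, [/\ fset F a, fset G b & a `&` b <= c].
Proof. by []. Qed.

Lemma fset_joinE F G c : fset (F `|` G) c <-> fset F c /\ fset G c.
Proof. by []. Qed.

Lemma leval_mono (w w' : nat -> L) t :
  (forall i, w i <= w' i) -> leval w t <= leval w' t.
Proof.
move=> ww'; elim: t => [i|s IHs t IHt|s IHs t IHt] //=.
  exact: leI2.
exact: leU2.
Qed.

(** Polynomials are monotone and filters are closed under meets, so witnesses
    for the subterms can be replaced by their pointwise meet. *)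
Lemma fset_leval v t c :
  fset (leval v t) c <->
  exists2 w, forall i, fset (v i) (w i) & leval w t <= c.
Proof.
have vI (w1 w2 : nat -> L) : (forall i, fset (v i) (w1 i)) ->
    (forall i, fset (v i) (w2 i)) -> forall i, fset (v i) (w1 i `&` w2 i).
  by move=> vw1 vw2 i; exact: filter_meet.
elim: t c => [i|s IHs t IHt|s IHs t IHt] c /=.
- split=> [vc|[w vw]]; last exact: filter_up.
  exists (fun j => if j == i then c else projT1 (cid (filter_ex (v j)))).
    by move=> j; case: eqP => [->//|_]; case: cid.
  by rewrite eqxx.
- split=> [[a [b [/IHs[w1 vw1 sa] /IHt[w2 vw2 tb] abc]]]|].
    exists (fun i => w1 i `&` w2 i); first exact: vI.
    apply: le_trans abc; apply: leI2.
      by apply: le_trans sa; apply: leval_mono => i; exact: leIl.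
    by apply: le_trans tb; apply: leval_mono => i; exact: leIr.
  case=> w vw stc; exists (leval w s), (leval w t); split=> //.
    by apply/IHs; exists w.
  by apply/IHt; exists w.
- split=> [[/IHs[w1 vw1 sc] /IHt[w2 vw2 tc]]|].
    exists (fun i => w1 i `&` w2 i); first exact: vI.
    rewrite leUx; apply/andP; split.
      by apply: le_trans sc; apply: leval_mono => i; exact: leIl.
    by apply: le_trans tc; apply: leval_mono => i; exact: leIr.
  case=> w vw; rewrite leUx => /andP[sc tc]; split.
    by apply/IHs; exists w.
  by apply/IHt; exists w.
Qed.

Lemma filter_satisfies e : satisfies L e -> satisfies lfilter e.
Proof.
move=> Le v; apply: val_inj => /=; apply/seteqP; split=> c /fset_leval[w vw ec];
by apply/fset_leval; exists w => //; rewrite (Le, =^~ Le).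
Qed.

Fact principal_subproof a : is_filter [set b | a <= b].
Proof.
split; first by exists a => /=.
  by move=> b c /= ab; exact: le_trans.
by move=> b c /= ab ac; rewrite lexI ab.
Qed.

Definition principal a := MkFilter (asboolT (principal_subproof a)).

Lemma le_principal F a : fset F a <-> F <= principal a.
Proof.
split=> [Fa|/filter_leP]; last by apply; exact: lexx.
by apply/filter_leP => b; exact: filter_up.
Qed.

Lemma principalI a b : principal (a `&` b) = principal a `&` principal b.
Proof.
apply/le_anti/andP; split.
  by rewrite lexI; apply/andP; split; apply/le_principal; rewrite /= (leIl, leIr).
apply/le_principal/fset_meetE; exists a, b; split=> //=; exact: lexx.
Qed.

Lemma principalU a b : principal (a `|` b) = principal a `|` principal b.
Proof.
apply/le_anti/andP; split.
  by apply/filter_leP => c /fset_joinE[/= ac bc]; rewrite leUx ac.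
by rewrite leUx; apply/andP; split; apply/le_principal; rewrite /= (leUl, leUr).
Qed.

(** Zorn's lemma; avoiding [Z] is preserved by unions of chains.  With a
    singleton for [Z] this produces join-irreducible filters, with the
    difference of two filters it produces minimal joinands. *)
Lemma filter_avoiding F (Z : set L) : (forall z, fset F z -> ~ Z z) ->
  exists X : lfilter, [/\ X <= F, forall z, fset X z -> ~ Z z &
    forall Y, Y <= X -> (forall z, fset Y z -> ~ Z z) -> Y = X].
Proof.
move=> FZ; pose T := {X : lfilter | X <= F /\ forall z, fset X z -> ~ Z z}.
pose inT X PX : T := exist _ X PX.
pose R (X Y : T) := sval Y <= sval X.
have [] := @Zorn T R; rewrite /R.
- by move=> X; exact: lexx.
- by move=> X Y W YX WY; exact: le_trans YX.
- move=> [X PX] [Y PY] /= YX XY; apply: eq_exist => /=; apply: le_anti.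
  by rewrite YX XY.
- move=> C Ctot; case: (pselect (exists X, C X)) => [[X0 CX0]|noC]; last first.
    by exists (inT F (conj (lexx F) FZ)) => X CX; case: noC; exists X.
  pose U : set L := [set z | exists2 X, C X & fset (sval X) z]%classic.
  have Uf : is_filter U.
    split.
    - by have [a Xa] := filter_ex (sval X0); exists a, X0.
    - by move=> a b [X CX Xa] ab; exists X => //; exact: filter_up ab.
    - move=> a b [X CX Xa] [Y CY Yb].
      case: (Ctot _ _ CX CY) => /filter_leP XY.
        by exists Y => //; apply: filter_meet => //; exact: XY.
      by exists X => //; apply: filter_meet => //; exact: XY.
  have UX X : C X -> MkFilter (asboolT Uf) <= sval X.
    by move=> CX; apply/filter_leP => a Xa; exists X.
  suff PU : MkFilter (asboolT Uf) <= F /\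
      forall z, fset (MkFilter (asboolT Uf)) z -> ~ Z z.
    by exists (inT _ PU) => X /UX.
  split; first by apply: le_trans (UX _ CX0) _; case: (svalP X0).
  by move=> z [X CX Xz]; case: (svalP X) => _; exact.
move=> [X [XF XZ]] Xmax; exists X; split=> // Y YX YZ.
by have /= := Xmax (inT Y (conj (le_trans YX XF) YZ)) YX; move/(congr1 sval).
Qed.

End Filters.

(** * Covers of join-irreducible elements *)
Section JoinIrreducible.
Local Open Scope order_scope.
Variables (d : Order.disp_t) (M : latticeType d).
Implicit Types (p q r a b x y z w : M).

(** A least element, if there is one, counts as join-irreducible: it has no
    covers, and the nodes labelled by it, which lie in the image of every
    element, are harmless. *)
Definition ji p : Prop := forall a b, p = a `|` b -> p = a \/ p = b.

Lemma ji_le_join p a b :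
  ji p -> a <= p -> b <= p -> p <= a `|` b -> p <= a \/ p <= b.
Proof.
move=> jp ap bp pab; have : p = a `|` b by apply: le_anti; rewrite pab leUx ap.
by case/jp=> <-; [left|right].
Qed.

(** The way identities are used below: one of the joinands on the right-hand
    side must be the join-irreducible value of the left-hand side. *)
Lemma ji_joins (v : nat -> M) p l : ji p -> l != [::] ->
  p = leval v (joins l) -> exists2 t, t \in l & p = leval v t.
Proof.
case: l => [|t0 l] //= jp _; elim: l t0 => [|t1 l IHl] t0 /= pE.
  by exists t0; rewrite ?mem_head.
have [t tl pt] := IHl _ pE; move: tl; rewrite in_cons => /orP[/eqP tE|tl].
  have [E|E] := jp _ _ (etrans pt (congr1 (leval v) tE)).
    by exists t0; rewrite ?mem_head.
  by exists t1; rewrite // !in_cons eqxx orbT.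
by exists t; rewrite // !in_cons tl !orbT.
Qed.

Lemma le_of_eq a b : a = b -> a <= b. Proof. by move->. Qed.

(** The property for which [L] is extended to its filters: it lets every
    inequality [p <= a \/ b] shrink to a cover. *)
Definition minimal_joinands : Prop := forall p a b, p <= a `|` b ->
  exists x, [/\ x <= a, p <= x `|` b & forall y, y <= x -> p <= y `|` b -> y = x].

Section Instances.
Hypotheses (MS : satisfies M idS) (MU : satisfies M idU) (MB : satisfies M idB).

Lemma jiS p x y b0 b1 : ji p -> p <= x `|` y -> ~ p <= x -> x <= b0 `|` b1 ->
  exists2 b, b = b0 \/ b = b1 & p <= b `|` y /\ p <= (x `&` (p `|` b)) `|` y.
Proof.
move=> jp pxy npx xb; have := MS (nth p [:: p; x; b0; b1; y]).
rewrite /= (meet_idPl xb) (meet_idPl pxy) => pE.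
case: (jp _ _ pE) => [px|/jp[pb|pb]].
- by case: npx; apply/meet_idPl.
- exists b0; first by left.
  by move: (le_of_eq pb); rewrite !lexI => /andP[/andP[_ ->] ->].
- exists b1; first by right.
  by move: (le_of_eq pb); rewrite !lexI => /andP[/andP[_ ->] ->].
Qed.

Lemma jiU p a b c : ji p -> p <= a `|` b -> p <= b `|` c -> p <= a `|` c ->
  [\/ p <= a, p <= b | p <= c].
Proof.
move=> jp pab pbc pac; have := MU (nth p [:: p; a; b; c]) => /=.
rewrite (meet_idPl pab) (meet_idPl pbc) (meet_idPl pac).
case/jp=> [/jp[]|] ->.
- by constructor 1; rewrite -meetA leIxr // leIl.
- by constructor 2; rewrite -meetA leIxr // leIl.
- by constructor 3; rewrite -meetA leIxr // leIl.
Qed.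

Lemma jiB p a0 a1 b0 b1 : ji p -> p <= a0 `|` a1 -> p <= b0 `|` b1 ->
  ~ p <= a0 -> ~ p <= a1 -> ~ p <= b0 -> ~ p <= b1 ->
  (p <= a0 `|` b0 /\ p <= a1 `|` b1) \/ (p <= a0 `|` b1 /\ p <= a1 `|` b0).
Proof.
move=> jp pa pb na0 na1 nb0 nb1.
have := MB (nth p [:: p; a0; a1; b0; b1]) => /=.
rewrite (meet_idPl pa) (meet_idPl pb).
case/jp=> [/jp[/jp[/jp[]|/jp[]]|]|] pE.
- by case: na0; rewrite pE -meetA leIxr // leIl.
- by case: nb0; rewrite pE -meetA leIxr // leIl.
- by case: na1; rewrite pE -meetA leIxr // leIl.
- by case: nb1; rewrite pE -meetA leIxr // leIl.
- by left; move: (le_of_eq pE); rewrite !lexI => /andP[/andP[_ ->] ->].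
- by right; move: (le_of_eq pE); rewrite !lexI => /andP[/andP[_ ->] ->].
Qed.

(** Minimality in each joinand separately; it forces both to be
    join-irreducible ([min_ji]). *)
Record mincover p x y : Prop := Cover {
  cover_ji : ji p;
  cover_jil : ji x;
  cover_jir : ji y;
  cover_le : p <= x `|` y;
  cover_nlel : ~ p <= x;
  cover_nler : ~ p <= y;
  cover_minl : forall x', x' <= x -> p <= x' `|` y -> x' = x;
  cover_minr : forall y', y' <= y -> p <= x `|` y' -> y' = y }.

Lemma cover_sym p x y : mincover p x y -> mincover p y x.
Proof.
case=> jp jx jy pxy npx npy minx miny; split=> //; first by rewrite joinC.
  by move=> z zy; rewrite joinC; exact: miny.
by move=> z zx; rewrite joinC; exact: minx.
Qed.

(** If [x = b0 \/ b1], then (S) bounds [p] by some [b_i \/ y], and minimality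
    gives [b_i = x]. *)
Lemma min_ji p x y : ji p -> p <= x `|` y -> ~ p <= x ->
  (forall x', x' <= x -> p <= x' `|` y -> x' = x) -> ji x.
Proof.
move=> jp pxy npx minx b0 b1 xE.
have [b bE [pby _]] := jiS jp pxy npx (le_of_eq xE).
have bx : b <= x by rewrite xE; case: bE => ->; rewrite (leUl, leUr).
by move: (minx _ bx pby) bE => <- [] <-; [left|right].
Qed.

(** For [p] not below [z], the only alternative left by (B) is
    [p <= y \/ y']; together with the two covers this would contradict (U). *)
Lemma cover_indep p x y y' z :
  mincover p x y -> mincover p x y' -> p <= z `|` y -> p <= z `|` y'.
Proof.
move=> cxy cxy' pzy; case: (pselect (p <= z)) => [pz|npz]; first by rewrite lexU2 ?pz.
have jp := cover_ji cxy; have pxy := cover_le cxy; have pxy' := cover_le cxy'.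
have npx := cover_nlel cxy; have npy := cover_nler cxy.
have npy' := cover_nler cxy'.
case: (jiB jp pzy pxy' npz npy npx npy') => [[pzx pyy']|[] //].
by case: (jiU jp pxy pyy' pxy').
Qed.

(** Relative to a cover [(x, y)] of [q], the betweenness pattern [z, x, q, y]:
    in a representation [z] is on the far side of [x] from [q]. *)
Definition beyond q x y z : Prop := x <= q `|` z /\ q <= z `|` y.

(** [K] singles out one of the two sides of [x]: at least one joinand of every
    cover of [x] is on this side, and [x] is not between two elements of it. *)
Definition polarity x (K : M -> Prop) : Prop :=
  (forall z w, mincover x z w -> K z \/ K w) /\
  (forall z w, K z -> K w -> x <= z `|` w -> x <= z \/ x <= w).

Lemma polarity_opp x K z w z' w' : polarity x K ->
  mincover x z w -> mincover x z' w' -> K z -> ~ K z' -> x <= z `|` z'.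
Proof.
move=> [K1 K2] czw czw' Kz nKz'.
have Kw' : K w' by case: (K1 _ _ czw').
have [jx [nz nw]] := (cover_ji czw, (cover_nlel czw, cover_nler czw)).
have [nz' nw'] := (cover_nlel czw', cover_nler czw').
case: (jiB jx (cover_le czw) (cover_le czw') nz nw nz' nw') => [[]//|[xzw' _]].
by case: (K2 _ _ Kz Kw' xzw').
Qed.

Lemma polarity_cover x K z w : polarity x K -> mincover x z w -> K z -> ~ K w.
Proof.
move=> [_ K2] c Kz Kw; case: (K2 _ _ Kz Kw (cover_le c)).
  exact: cover_nlel c.
exact: cover_nler c.
Qed.

(** (S), with the minimality of [x] in the cover turning its second condition
    into [x <= q \/ b]. *)
Lemma cover_beyond q x y b0 b1 : mincover q x y -> x <= b0 `|` b1 ->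
  beyond q x y b0 \/ beyond q x y b1.
Proof.
move=> c xb; have [b bE [qby]] := jiS (cover_ji c) (cover_le c) (cover_nlel c) xb.
move/(cover_minl c)=> /(_ (leIl _ _)) /meet_idPl xqb.
by case: bE => <-; [left|right].
Qed.

(** For two elements beyond [x], neither above [x] but with join above [x],
    (U) leaves only [x <= q]; then both conditions on [q] hold for [x] too, and
    (U) gives [x <= y], hence [q <= y]. *)
Lemma cover_polarity q x y : mincover q x y -> polarity x (beyond q x y).
Proof.
move=> c; split=> [z w czw|z w [xqz qzy] [xqw qwy] xzw].
  exact/(cover_beyond c)/cover_le.
have jx := cover_jil c.
have [xq|xz|xw] := jiU jx xqz xzw xqw; [|by left|by right].
have xyw : x <= y `|` w by rewrite joinC (le_trans xq qwy).
have [xz|xy|xw] := jiU jx (le_trans xq qzy) xyw xzw.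
- by left.
- case: (cover_nler c); rewrite (le_trans (cover_le c)) //.
  by rewrite leUx xy lexx.
- by right.
Qed.

Section Minimal.
Hypothesis minimal_left : minimal_joinands.

Lemma cover_exists p a b : ji p -> p <= a `|` b -> ~ p <= a -> ~ p <= b ->
  exists x y, [/\ x <= a, y <= b & mincover p x y].
Proof.
move=> jp pab npa npb.
have [x [xa pxb minx]] := minimal_left pab.
rewrite joinC in pxb; have [y [yb pyx miny]] := minimal_left pxb.
have npx : ~ p <= x by move=> px; exact: npa (le_trans px xa).
have npy : ~ p <= y by move=> py; exact: npb (le_trans py yb).
have minx' x' : x' <= x -> p <= x' `|` y -> x' = x.
  by move=> xx px'y; apply: minx => //; apply: (le_trans px'y); rewrite leU2.
exists x, y; split=> //; split=> //.
- by apply: min_ji minx' => //; rewrite joinC.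
- by apply: min_ji miny.
- by rewrite joinC.
- by move=> y' yy; rewrite joinC; exact: miny.
Qed.

(** A joinand of one cover of [p] stays minimal opposite to any other [b], for
    by (B) a smaller one could replace it in the given cover as well. *)
Lemma cover_extend p x y0 b : mincover p x y0 -> p <= x `|` b -> ~ p <= b ->
  exists2 y, y <= b & mincover p x y.
Proof.
move=> c pxb npb; have jp := cover_ji c.
have [x' [y [x'x yb c']]] := cover_exists jp pxb (cover_nlel c) npb.
exists y => //; suff <- : x' = x by [].
have [n1 [n2 [n3 n4]]] :=
  (cover_nlel c', (cover_nler c', (cover_nlel c, cover_nler c))).
case: (jiB jp (cover_le c') (cover_le c) n1 n2 n3 n4) => [[]|[px'y0 _]].
  by rewrite (join_r x'x) => /n3.
exact: cover_minl c _ x'x px'y0.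
Qed.

(** At the root of a tree there is no previous cover.  Seen from a joinand [r]
    of some cover of [p], in the degenerate pattern [z, p, r, r], the elements
    beyond [p] are those on the side opposite to [r]. *)
Lemma root_polarity p r :
  ji p -> (exists s, mincover p r s) \/ (forall x y, ~ mincover p x y) ->
  polarity p (beyond r p r).
Proof.
move=> jp root; split=> [z w c|z w [pz _] [pw _] pzw].
  case: root => [[s crs]|/(_ _ _ c)] //.
  have [n1 [n2 [n3 n4]]] :=
    (cover_nlel c, (cover_nler c, (cover_nlel crs, cover_nler crs))).
  case: (jiB jp (cover_le c) (cover_le crs) n1 n2 n3 n4) => [[pzr _]|[_ pwr]].
    by left; split; rewrite 1?joinC // leUl.
  by right; split; rewrite 1?joinC // leUl.
case: root => [[s crs]|nc].
  by case: (jiU jp pz pzw pw) => [/(cover_nlel crs)||]; [|left|right].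
case: (pselect (p <= z)) => [|npz]; first by left.
case: (pselect (p <= w)) => [|npw]; first by right.
by have [x [y [_ _ /nc]]] := cover_exists jp pzw npz npw.
Qed.

(** Successive covers, each leading beyond the preceding one. *)
Definition track (X X' : nat -> M) n : Prop :=
  (forall i, (i < n)%N -> mincover (X i) (X i.+1) (X' i.+1)) /\
  (forall i, (i.+1 < n)%N -> beyond (X i) (X i.+1) (X' i.+1) (X i.+2)).

Lemma track_shift X X' n : track X X' n.+1 -> track (X \o succn) (X' \o succn) n.
Proof. by move=> [Xc Xp]; split=> i lt_in; [exact: Xc|exact: Xp]. Qed.

Lemma track_leq X X' m n : (m <= n)%N -> track X X' n -> track X X' m.
Proof.
by move=> mn [Xc Xp]; split=> i im; [apply: Xc|apply: Xp]; exact: leq_trans mn.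
Qed.

(** Induction on the tail of the track.  To bound [X 1], the joinand opposite
    to [X 2] is moved below [X 0] by [cover_extend].  To bound [X 0], (S) is
    applied to the bound of [X 1] by [X' 2] and the last element; its other
    outcome would put [X' 2] beyond [X 1], where [X 2] already is. *)
Lemma track_hull X X' n : track X X' n.+1 ->
  X 0 <= X n.+1 `|` X' 1 /\ forall i, (i <= n.+1)%N -> X i <= X 0 `|` X n.+1.
Proof.
elim: n X X' => [|n IHn] X X' tr; have [Xc Xp] := tr; have c0 := Xc 0%N isT.
  split; first exact: cover_le.
  by case=> [|[]] // _; rewrite (leUl, leUr).
have [/= IH1 IH2] := IHn _ _ (track_shift tr).
have [p1 p2] := Xp 0%N isT; have c1 := Xc 1%N isT.
have X1 : X 1%N <= X 0%N `|` X n.+2.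
  case: (pselect (X 1%N <= X 0%N)) => [le10|nle10]; first by rewrite lexU2 ?le10.
  rewrite joinC in p1; have [y yX0 c1'] := cover_extend c1 p1 nle10.
  by apply: (le_trans (cover_indep c1 c1' IH1)); rewrite joinC leU2.
split; last first.
  case=> [_|i lt_in]; first exact: leUl.
  by apply: (le_trans (IH2 i lt_in)); rewrite leUx X1 leUr.
case: (cover_beyond c0 IH1) => [[]//|Xb'].
by case: (polarity_cover (cover_polarity c0) c1 (Xp 0%N isT)).
Qed.

Lemma track_nle X X' n : track X X' n.+1 -> ~ X 0%N <= X n.+1.
Proof.
elim: n X X' => [|n IHn] X X' tr.
  by case: tr => /(_ 0%N isT) /cover_nlel.
move=> X0n; apply: (IHn _ _ (track_shift tr)) => /=.
have [_ /(_ 1%N isT)] := track_hull tr.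
by rewrite (join_idPr X0n).
Qed.

(** In the bound [X 0 <= X m \/ X' 1] the mate [X' 1] can be moved below
    [Y 1]; then [X m] is opposite to [Y 1], and in [Y 0 <= Y n \/ Y' 1] the
    mate [Y' 1] can be moved below [X m]. *)
Lemma tracks_hull X X' m Y Y' n : track X X' m -> track Y Y' n ->
  X 0%N = Y 0%N -> ((0 < m)%N -> (0 < n)%N -> X 0%N <= X 1%N `|` Y 1%N) ->
  X 0%N <= X m `|` Y n.
Proof.
case: m => [|m]; first by rewrite leUl.
case: n => [|n]; first by move=> _ _ ->; rewrite leUr.
move=> trX trY XY /(_ isT isT) XY1.
have [[Xc _] [Yc _]] := (trX, trY).
have [[h _] [k _]] := (track_hull trX, track_hull trY).
have [cX cY] := (Xc 0%N isT, Yc 0%N isT).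
have [] := cover_extend cX XY1; first by rewrite XY; exact: cover_nlel cY.
move=> y yY1 cXy; have XmY1 := le_trans (cover_indep cX cXy h) (leU2 (lexx _) yY1).
rewrite XY joinC in XmY1; have [|y' y'Xm cYy'] := cover_extend cY XmY1.
  by rewrite -XY; exact: track_nle trX.
rewrite XY joinC; apply: (le_trans (cover_indep cY cYy' k)).
by rewrite leU2.
Qed.

Section Evaluation.
Variables (X X' : nat -> M) (n : nat) (v : nat -> M) (x x' : nat -> lterm).
Hypotheses (trX : track X X' n)
  (vx : forall i, (i <= n)%N -> leval v (x i) = X i)
  (vx' : forall i, (0 < i <= n)%N -> leval v (x' i) = X' i).

Lemma leval_polU i : (i <= n)%N -> leval v (polU_ x x' i n) = X i.
Proof.
move=> le_in; have [k kE] : exists k, (n - i)%N = k by exists (n - i)%N.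
elim: k i le_in kE => [|k IHk] i le_in kE.
  have -> : i = n by apply/eqP; rewrite eqn_leq le_in -subn_eq0 kE.
  by rewrite /polU_ subnn /= vx.
have lt_in : (i < n)%N by rewrite -subn_gt0 kE.
rewrite polU_step //= IHk // ?subnS ?kE // vx ?vx' //.
by case: trX => Xc _; apply/meet_idPl/cover_le/Xc.
Qed.

(** Along a track the nesting preserves strictness: each [X j.+1] is minimal
    in its cover, so a strictly smaller inner value cannot bound [X j]. *)
Lemma leval_nest e j k : (j + k <= n)%N -> leval v e <= X (j + k)%N ->
  ~ X (j + k)%N <= leval v e -> ~ X j <= leval v (nest x x' e j k).
Proof.
suff H : (j + k <= n)%N -> leval v e <= X (j + k)%N ->
  ~ X (j + k)%N <= leval v e -> leval v (nest x x' e j k) <= X j /\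
  ~ X j <= leval v (nest x x' e j k) by move=> h1 h2 h3; case: (H h1 h2 h3).
elim: k j => [|k IHk] j; first by rewrite addn0.
rewrite addnS -addSn => jkn eX nXe /=.
have jn : (j < n)%N by apply: leq_trans jkn; rewrite addSn ltnS leq_addr.
have [le1 nle1] := IHk _ jkn eX nXe.
rewrite vx 1?ltnW // vx' // leIl; split=> //.
rewrite lexI lexx /= => Xj; apply: nle1.
by case: trX => /(_ _ jn) c _; rewrite (cover_minl c le1 Xj).
Qed.

Lemma nle_polV i : (i < n)%N -> ~ X 0%N <= leval v (polV x x' i n).
Proof.
move=> lt_in; case: trX => /(_ _ lt_in) c _.
have vV : leval v ((x i `&` polU_ x x' i.+1 n) `|` (x i `&` x' i.+1))%lterm =
    (X i `&` X i.+1) `|` (X i `&` X' i.+1).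
  by rewrite /= leval_polU // vx 1?ltnW // vx'.
rewrite /polV /polV_ subn0; apply: leval_nest; rewrite add0n ?vV 1?ltnW //.
  by rewrite leUx !leIl.
case/(ji_le_join (cover_ji c) (leIl _ _) (leIl _ _)); rewrite lexI => /andP[_].
  exact: cover_nlel c.
exact: cover_nler c.
Qed.

(** If the innermost value of [W] were [X i], then [X' i.+2] would be beyond
    [X i.+1], together with its partner [X i.+2] in a cover. *)
Lemma nle_polW i : (i < n - 1)%N -> ~ X 0%N <= leval v (polW x x' i n).
Proof.
rewrite ltn_subRL add1n => lt_in; case: trX => Xc Xp.
have lt_in' : (i < n)%N by exact: ltnW.
have [c0 c1] := (Xc _ lt_in', Xc _ lt_in).
pose w := X i `&` (X' i.+1 `|` X' i.+2)
   `&` ((X i.+1 `&` (X i `|` X' i.+2)) `|` X' i.+1).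
set e := ((x i `&` (x' i.+1 `|` x' i.+2)
   `&` ((polU_ x x' i.+1 n `&` (x i `|` x' i.+2)) `|` x' i.+1)))%lterm.
have vW : leval v e = w by rewrite /= leval_polU // vx 1?ltnW // !vx'.
rewrite /polW /polW_ subn0; apply: leval_nest; rewrite add0n ?vW 1?ltnW //.
  by rewrite /w -meetA leIl.
rewrite /w !lexI lexx /= => /andP[XiX' /(cover_minl c0)].
rewrite leIl => /(_ isT) /meet_idPl Xi1.
apply: (polarity_cover (cover_polarity c0) c1 (Xp _ lt_in)).
by split; rewrite // joinC.
Qed.

End Evaluation.

(** On a track [U_n] evaluates to [X 0], which is join-irreducible, while
    every [V_i] and [W_i] is strictly smaller. *)
Lemma idH_track n X X' : (0 < n)%N -> satisfies M (idH n) -> ~ track X X' n.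
Proof.
move=> n0 Hn trX; have jX : ji (X 0%N) by case: trX => /(_ _ n0) /cover_ji.
pose v k := if odd k then X' k./2 else X k./2.
set x : nat -> lterm := fun i => Var (2 * i).
set x' : nat -> lterm := fun i => Var (2 * i + 1).
have vx i : (i <= n)%N -> leval v (x i) = X i.
  by rewrite /= /v mul2n odd_double doubleK.
have vx' i : (0 < i <= n)%N -> leval v (x' i) = X' i.
  by rewrite /= /v mul2n addn1 /= odd_double uphalf_double.
have := Hn v; rewrite -[leval v (idH n).1]/(leval v (polU_ x x' 0 n)).
rewrite (leval_polU trX) // => /(ji_joins jX)[|t].
  by case: (n) n0.
rewrite mem_cat => /orP[] /mapP[i]; rewrite mem_iota => /andP[_ lt_in] -> XE.
  by apply: (nle_polV trX vx vx' lt_in); rewrite -XE.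
by apply: (nle_polW trX vx vx' lt_in); rewrite -XE.
Qed.

(** Only the last joinand of (H_{m,n}) could be [X 0]; it is below
    [X 1 \/ Y' 1], and (U) excludes this for [Y 1] and [Y' 1] are joinands of
    a cover and [X 1] is opposite to [Y 1]. *)
Lemma idH2_tracks m n X X' Y Y' : (0 < m)%N -> (0 < n)%N ->
  satisfies M (idH2 m n) -> track X X' m -> track Y Y' n ->
  X 0%N = Y 0%N -> ~ X 0%N <= X 1%N `|` Y 1%N.
Proof.
move=> m0 n0 Hmn trX trY XY0 XY1.
have cX : mincover (X 0%N) (X 1%N) (X' 1%N) by case: trX => /(_ _ m0).
have cY : mincover (X 0%N) (Y 1%N) (Y' 1%N) by rewrite XY0; case: trY => /(_ _ n0).
have jX := cover_ji cX.
pose v k := nth (X 0%N) [:: X (k %/ 4); X' (k %/ 4); Y (k %/ 4); Y' (k %/ 4)] (k %% 4).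
set x : nat -> lterm := fun i => Var (4 * i).
set x' : nat -> lterm := fun i => Var (4 * i + 1).
set y : nat -> lterm := fun i => if i is 0 then Var 0 else Var (4 * i + 2).
set y' : nat -> lterm := fun i => Var (4 * i + 3).
have v4 i k : (k < 4)%N -> v (4 * i + k)%N = nth (X 0%N) [:: X i; X' i; Y i; Y' i] k.
  by move=> k4; rewrite /v mulnC modnMDl divnMDl // modn_small // divn_small // addn0.
have vx i : (i <= m)%N -> leval v (x i) = X i.
  by rewrite /= -[(4 * i)%N]addn0 v4.
have vx' i : (0 < i <= m)%N -> leval v (x' i) = X' i by rewrite /= v4.
have vy i : (i <= n)%N -> leval v (y i) = Y i.
  by case: i => [|i] _ /=; [rewrite -XY0 | rewrite v4].
have vy' i : (0 < i <= n)%N -> leval v (y' i) = Y' i by rewrite /= v4.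
have := Hmn v.
rewrite -[leval v (idH2 m n).1]/(leval v (polU_ x x' 0 m) `&` leval v (polU_ y y' 0 n)).
rewrite (leval_polU trX) // (leval_polU trY) // -XY0 meetxx => /(ji_joins jX)[|t].
  by case: (m) m0.
rewrite !mem_cat mem_seq1; case/orP=> [|/orP[|/orP[|/orP[|/eqP->]]]].
- case/mapP=> i; rewrite mem_iota => /andP[_ lt_in] -> XE.
  by apply: (nle_polV trX vx vx' lt_in); rewrite {1}XE leIl.
- case/mapP=> i; rewrite mem_iota => /andP[_ lt_in] -> XE.
  by apply: (nle_polW trX vx vx' lt_in); rewrite {1}XE leIl.
- case/mapP=> i; rewrite mem_iota => /andP[_ lt_in] -> XE.
  by apply: (nle_polV trY vy vy' lt_in); rewrite -XY0 {1}XE leIr.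
- case/mapP=> i; rewrite mem_iota => /andP[_ lt_in] -> XE.
  by apply: (nle_polW trY vy vy' lt_in); rewrite -XY0 {1}XE leIr.
rewrite -/x -/x' -/y -/y' => XE.
have XY'1 : X 0%N <= X 1%N `|` Y' 1%N.
  rewrite -(vx 1%N) // -(vy' 1%N) // {1}XE /=.
  by rewrite leIxl // leIxr.
case: (jiU jX XY1 (cover_le cY) XY'1).
- exact: cover_nlel cX.
- exact: cover_nlel cY.
- exact: cover_nler cY.
Qed.

End Minimal.
End Instances.
End JoinIrreducible.

(** * The order of a directed tree *)
Section SignedWords.
Variable T : choiceType.

(** A word is a path from the root in a tree whose edges are directed by the
    Boolean components: up for [true], down for [false]. *)
Definition word : Type := seq (T * bool).
HB.instance Definition _ := Choice.on word.
Implicit Types (s t r g : word) (b : bool).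

Definition signed b s : bool := all (fun e => e.2 == b) s.

(** The path from [s] to [t] in the tree runs through their common prefix [g]
    and uses every edge upwards. *)
Definition word_le s t : bool :=
  `[< exists g s' t', [/\ s = g ++ s', t = g ++ t', signed false s' & signed true t'] >].

Lemma signed_nil b s : signed b s -> signed (~~ b) s -> s = [::].
Proof. by case: s => //= e s /andP[/eqP-> _]; case: b. Qed.

Lemma cat_overlap s1 s2 t1 t2 : s1 ++ s2 = t1 ++ t2 ->
  (exists r, t1 = s1 ++ r /\ s2 = r ++ t2) \/
  (exists r, s1 = t1 ++ r /\ t2 = r ++ s2).
Proof.
elim: s1 t1 => [|e s1 IHs] [|f t1] /=.
- by move=> ->; left; exists [::].
- by move=> ->; left; exists (f :: t1).
- by move=> <-; right; exists (e :: s1).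
by case=> -> /IHs[[r [-> ->]]|[r [-> ->]]]; [left|right]; exists r.
Qed.

(** The middle word is on the path from [s] to [r]: on its half towards [r] in
    the first case, on its half towards [s] in the second. *)
Lemma word_between s t r : word_le s t -> word_le t r ->
  exists g s' u r', signed false s' /\ signed true r' /\
   ([/\ s = g ++ s', t = g ++ u, r = g ++ u ++ r' & signed true u] \/
    [/\ s = g ++ u ++ s', t = g ++ u, r = g ++ r' & signed false u]).
Proof.
move=> /asboolP[g [s' [t1 [-> -> ns' pt1]]]].
move=> /asboolP[g' [t2 [r' [/cat_overlap[]]]]].
- case=> u [-> tE] -> nt2 pr'; rewrite tE in pt1 *.
  move: pt1; rewrite /signed all_cat => /andP[pu pt2].
  have {}tE : t2 = [::] by apply: (signed_nil nt2).
  exists g, s', u, r'; do 2!split=> //; left; split=> //; rewrite ?tE ?cats0 //.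
  by rewrite catA.
- case=> u [-> t2E] -> nt2 pr'; rewrite t2E in nt2.
  move: nt2; rewrite /signed all_cat => /andP[nu nt1].
  have tE : t1 = [::] by apply: signed_nil nt1 pt1.
  exists g', s', u, r'; do 2!split=> //; right; split=> //; rewrite ?tE ?cats0 //.
  by rewrite catA.
Qed.

Fact word_le_refl : reflexive word_le.
Proof. by move=> s; apply/asboolP; exists s, [::], [::]; rewrite cats0. Qed.

Fact word_le_trans : transitive word_le.
Proof.
move=> t s r st tr.
have [g [s' [u [r' [ns' [pr' [[-> _ -> pu]|[-> _ -> nu]]]]]]]] := word_between st tr.
  apply/asboolP; exists g, s', (u ++ r'); split=> //.
  by rewrite /signed all_cat; apply/andP.
apply/asboolP; exists g, (u ++ s'), r'; split=> //.
by rewrite /signed all_cat; apply/andP.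
Qed.

Definition ups s := count (fun e => e.2) s.
Definition downs s := count (fun e => ~~ e.2) s.

Lemma signed_count b s : signed b s ->
  ups s = (if b then size s else 0) /\ downs s = (if b then 0 else size s).
Proof.
rewrite /ups /downs; elim: s => [|e s IHs] /=; first by case: b.
by case: b IHs => IHs /andP[/eqP-> /IHs[-> ->]].
Qed.

(** The height of a word is [ups - downs]; stated with sums to remain in
    [nat], this is the height difference between the ends of an upward
    path. *)
Lemma height_cat g s' t' : signed false s' -> signed true t' ->
  ups (g ++ t') + downs (g ++ s') =
  ups (g ++ s') + downs (g ++ t') + (size s' + size t').
Proof.
move=> /signed_count[us ds] /signed_count[ut dt].
move: us ds ut dt; rewrite /ups /downs !count_cat => -> -> -> -> /=; lia.
Qed.

Fact word_le_anti : antisymmetric word_le.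
Proof.
move=> s t /andP[/asboolP[g [s' [t' [sE tE ns' pt']]]]].
move=> /asboolP[h [t1 [s1 [tE1 sE1 nt1 ps1]]]].
have := height_cat g ns' pt'; have := height_cat h nt1 ps1.
rewrite -sE -tE -sE1 -tE1 => h1 h2.
have : (size s' == 0) && (size t' == 0) by lia.
by rewrite !size_eq0 sE tE => /andP[/eqP-> /eqP->].
Qed.

Fact word_display : Order.disp_t. Proof. exact: Order.Disp tt tt. Qed.

HB.instance Definition _ := Order.Le_isPOrder.Build word_display word
  word_le_refl word_le_anti word_le_trans.

Lemma lt_height s t : (s < t)%O -> ups s + downs t < ups t + downs s.
Proof.
rewrite lt_neqAle => /andP[st /asboolP[g [s' [t' [sE tE ns' pt']]]]].
have := height_cat g ns' pt'; rewrite -sE -tE => ->.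
suff : size s' + size t' != 0 by lia.
apply: contra st; rewrite addn_eq0 !size_eq0 sE tE => /andP[/eqP-> /eqP->].
by rewrite !cats0.
Qed.

Lemma path_height s (c : seq word) : path <%O s c ->
  (s <= last s c)%O /\ ups s + downs (last s c) + size c <= ups (last s c) + downs s.
Proof.
elim: c s => [|t c IHc] s /=; first by rewrite lexx addn0.
case/andP=> st /IHc[tl h]; split; first exact: le_trans (ltW st) tl.
have := lt_height st; lia.
Qed.

(** Heights increase strictly along a chain, so the path between its extreme
    elements is at least as long as the chain. *)
Lemma chain_size (c : seq word) : uniq c -> {in c &, forall s t, (s >=< t)%O} ->
  c = [::] \/ exists s t g s' t', [/\ s \in c, t \in c, s = g ++ s' /\ t = g ++ t',
    signed false s' /\ signed true t' & (size c).-1 <= size s' + size t'].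
Proof.
move=> uc cc; pose c' := sort <=%O c.
have srt : sorted <%O c'.
  rewrite lt_sorted_uniq_le sort_uniq uc.
  apply: (sort_sorted_in (P := mem c)); last exact/allP.
  by move=> s t sc tc; exact: cc.
have cE := mem_sort <=%O c; have sz := size_sort <=%O c; rewrite -/c' in cE sz.
case: c' srt cE sz => [|s c'] srt cE sz.
  by left; apply/eqP; rewrite -size_eq0 -sz.
have [/asboolP[g [s' [t' [sE tE ns' pt']]]] h] := path_height srt.
right; exists s, (last s c'), g, s', t'; split=> //.
- by rewrite -cE mem_head.
- by rewrite -cE mem_last.
have := height_cat g ns' pt'; rewrite -sE -tE -sz /=; lia.
Qed.

End SignedWords.

(** * The tree of covers *)
Section Tree.
Local Open Scope order_scope.
Variables (d : Order.disp_t) (M : latticeType d).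
Hypotheses (MS : satisfies M idS) (MU : satisfies M idU) (MB : satisfies M idB).
Hypothesis minimal_left : minimal_joinands M.

(** An edge of the tree: for the parent label [q], a cover [(x, y)] of [q]
    leading to a child labelled [x], and the direction of the edge. *)
Definition entry : Type := (M * M * M * bool)%type.
Definition parent (e : entry) : M := e.1.1.1.
Definition label (e : entry) : M := e.1.1.2.
Definition mate (e : entry) : M := e.1.2.
Definition continues (e : entry) : M -> Prop := beyond (parent e) (label e) (mate e).

Definition step (e f : entry) : bool :=
  `[< [/\ parent f = label e, mincover (label e) (label f) (mate f)
        & f.2 = e.2 <-> continues e (label f)] >].

(** The virtual edge into a root labelled [p] comes from a joinand [r] of a
    cover of [p], which is its own mate, as in [root_polarity]; if [p] has no
    covers, [r] is arbitrary.  Making it upward keeps different trees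
    incomparable. *)
Definition root (e : entry) : Prop :=
  [/\ ji (label e), parent e = mate e, e.2 &
    (exists s, mincover (label e) (mate e) s) \/ (forall x y, ~ mincover (label e) x y)].

Definition valid (s : word (M * M * M)%type) : bool :=
  if s is e :: s' then `[< root e >] && path step e s' else false.

Record node := Node { node_word : word (M * M * M)%type; nodeP : valid node_word }.
HB.instance Definition _ := [isSub for node_word].
HB.instance Definition _ := [Choice of node by <:].
Fact node_display : Order.disp_t. Proof. exact: Order.Disp tt tt. Qed.
HB.instance Definition _ := [SubChoice_isSubPOrder of node by <: with node_display].

(** The condition under which the children of a node are directed
    consistently. *)
Definition oriented (e : entry) : Prop :=
  ji (label e) /\ polarity (label e) (continues e).

Lemma root_oriented e : root e -> oriented e.
Proof.
case=> je pe _ re; split; rewrite /continues ?pe //.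
exact: root_polarity.
Qed.

Lemma path_oriented e s : oriented e -> path step e s -> oriented (last e s).
Proof.
elim: s e => [|f s IHs] e //= _ /andP[/asboolP[pf c _] fs]; apply: IHs fs.
by split; [exact: cover_jil c|rewrite /continues pf; exact: cover_polarity].
Qed.

(** Edges in a row with the same direction lead beyond each other by
    definition of [step]. *)
Lemma path_track e b s : path step e s -> signed b s ->
  track (fun i => label (nth e (e :: s) i)) (fun i => mate (nth e (e :: s) i)) (size s).
Proof.
move=> es bs; split=> i lt_in.
  by have /asboolP[_] := pathP e es i lt_in.
have lt_in' := ltnW lt_in.
have /asboolP[pE _ _] := pathP e es i lt_in'.
have /asboolP[_ _ [+ _]] := pathP e es i.+1 lt_in.
rewrite /continues pE; apply=> /=.
by rewrite (eqP (all_nthP e bs _ lt_in)) (eqP (all_nthP e bs _ lt_in')).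
Qed.

Lemma opposite_heads e f g : oriented e -> step e f -> step e g -> f.2 != g.2 ->
  label e <= label f `|` label g.
Proof.
move=> [_ pe] /asboolP[_ cf bf] /asboolP[_ cg bg] fg.
case: (eqVneq f.2 e.2) => [fe|nfe].
  apply: (polarity_opp MB pe cf cg); first exact/bf.
  by move/bg => ge; rewrite fe ge eqxx in fg.
rewrite joinC; apply: (polarity_opp MB pe cg cf).
  by apply/bg; move: fg nfe; case: f.2 g.2 e.2 => [] [] [].
by move/bf => fe; rewrite fe eqxx in nfe.
Qed.

Lemma signed_paths_heads e s t b : oriented e ->
  path step e s -> path step e t -> signed b s -> signed (~~ b) t ->
  0 < size s -> 0 < size t ->
  label e <= label (nth e (e :: s) 1) `|` label (nth e (e :: t) 1).
Proof.
case: s t => [|f s] [|g t] //= oe /andP[ef _] /andP[eg _].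
case/andP=> /eqP fb _ /andP[/eqP gb _] _ _; apply: opposite_heads => //.
by rewrite fb gb; case: (b).
Qed.

Lemma nth_size_last e (s : seq entry) : nth e (e :: s) (size s) = last e s.
Proof. by rewrite (last_nth e). Qed.

(** The ends of a monotone path of the tree are the last entries of [s] and
    [t]; its vertices on the [t] half are bounded by the join of the labels of
    these ends. *)
Lemma path_hull e s t b f : oriented e ->
  path step e s -> path step e t -> signed b s -> signed (~~ b) t ->
  f \in e :: t -> label f <= label (last e s) `|` label (last e t).
Proof.
move=> oe es et bs bt.
have trs := path_track es bs; have trt := path_track et bt.
have main : label e <= label (last e s) `|` label (last e t).
  rewrite -!nth_size_last.
  apply: (tracks_hull MS MU MB minimal_left trs trt) => // s0 t0.
  exact: signed_paths_heads bs bt s0 t0.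
case/(nthP e)=> i; rewrite ltnS => it <-.
case: t => [|g t] in et bt trt main it *; first by case: i it.
have [_ /(_ i it)] := track_hull MS MU MB minimal_left trt.
rewrite nth_size_last => h; apply: (le_trans h) => /=.
by rewrite leUx main leUr.
Qed.

Definition lies_under (a : M) (s : node) : Prop :=
  if node_word s is e :: s' then label (last e s') <= a else False.

(** The common prefix contains the root, so that the two halves of the path
    leave a node with a label of its own. *)
Lemma node_split s t g s' t' : node_word s = g ++ s' -> node_word t = g ++ t' ->
  signed false s' ->
  exists e g', [/\ g = e :: g', oriented (last e g'), path step (last e g') s',
    path step (last e g') t' &
    (forall a, lies_under a s <-> label (last (last e g') s') <= a) /\
    (forall a, lies_under a t <-> label (last (last e g') t') <= a)].
Proof.
case: s t => [s vs] [t vt] /= sE tE ns'; subst s t.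
case: g => [|e g] in vs vt *.
  (* Roots are upward, so a nonempty downward word is not a node. *)
  exfalso; move: vs; case: s' ns' => //= f s' /andP[/eqP ff _].
  by move=> /andP[/asboolP[_ _]]; rewrite ff.
have /= := vs; rewrite cat_path => /and3P[/asboolP re eg gs].
have /= := vt; rewrite cat_path => /and3P[_ _ gt]; exists e, g; split=> //.
  exact: path_oriented (root_oriented re) eg.
by rewrite /lies_under /=; split=> a; rewrite last_cat.
Qed.

Lemma lies_under_convex a : order_convex (lies_under a).
Proof.
move=> s r t su ru st tr.
have [g [s' [u [r' [ns' [pr' [[sE tE rE pu]|[sE tE rE nu]]]]]]]] := word_between st tr.
- have pur : signed true (u ++ r') by rewrite /signed all_cat; apply/andP.
  have [e [g' [gE oe es er [sU rU]]]] := node_split sE rE ns'.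
  have [e2 [g2 [gE2 _ _ _ [_ tU]]]] := node_split sE tE ns'.
  move: gE2 tU; rewrite gE => -[<- <-] tU.
  move: su ru; rewrite sU rU tU => su ru.
  have : label (last (last e g') u) <=
      label (last (last e g') s') `|` label (last (last e g') (u ++ r')).
    apply: (path_hull oe es er ns' pur).
    by rewrite -cat_cons mem_cat mem_last.
  by move/le_trans; apply; rewrite leUx su.
- have nus : signed false (u ++ s') by rewrite /signed all_cat; apply/andP.
  have [e [g' [gE oe es er [sU rU]]]] := node_split sE rE nus.
  have [e2 [g2 [gE2 _ _ _ [tU _]]]] := node_split tE rE nu.
  move: gE2 tU; rewrite gE => -[<- <-] tU.
  move: su ru; rewrite sU rU tU => su ru.
  have : label (last (last e g') u) <=
      label (last (last e g') r') `|` label (last (last e g') (u ++ s')).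
    apply: (path_hull oe er es pr' nus).
    by rewrite -cat_cons mem_cat mem_last.
  by move/le_trans; apply; rewrite leUx ru.
Qed.

Definition co_under (a : M) : Co node := MkCo (asboolT (@lies_under_convex a)).

Lemma co_underI a b : co_under (a `&` b) = co_under a `&` co_under b.
Proof.
apply: val_inj; apply/seteqP; rewrite /lies_under; split=> s /=; rewrite /lies_under /=.
  by case: (node_word s) => // e s'; rewrite lexI => /andP[].
by case: (node_word s) => [|e s'] -[] // sa sb; rewrite lexI sa.
Qed.

Lemma co_under_le a b : a <= b -> co_under a <= co_under b.
Proof.
move=> ab; apply: co_leP => s /=; rewrite /lies_under.
by case: (node_word s) => // e s'; move/le_trans; apply.
Qed.

(** The direction [b] of the new edge is forced by the definition of
    [step]. *)
Lemma cover_child (s : node) e s' x y : node_word s = e :: s' ->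
  mincover (label (last e s')) x y ->
  exists b (t : node), [/\ b = (last e s').2 <-> continues (last e s') x,
    forall a, x <= a -> lies_under a t & if b then s <= t else t <= s].
Proof.
case: s => s vs /= sE c; subst s; set l := last e s' in c *.
pose b := if `[< continues l x >] then l.2 else ~~ l.2.
have bE : b = l.2 <-> continues l x.
  by rewrite /b; case: asboolP => // nc; split=> //; case: (l.2).
pose f : entry := (label l, x, y, b).
have vt : valid (e :: rcons s' f).
  have /= /andP[-> es] := vs; rewrite rcons_path es /=.
  by apply/asboolP; split.
exists b, (Node vt); split=> //.
  by move=> a xa; rewrite /lies_under /= last_rcons.
case: (b) @f vt => f vt; apply/asboolP; exists (e :: s').
  by exists [::], [:: f]; rewrite cats0 cats1.
by exists [:: f], [::]; rewrite cats0 cats1.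
Qed.

(** If the label of [s] is below [a \/ b] but below neither, it has a cover
    [(x, y)] with [x <= a] and [y <= b].  The children for [(x, y)] and
    [(y, x)] lie on different sides of [s] by [polarity]. *)
Lemma co_underU a b : co_under (a `|` b) = co_under a `|` co_under b.
Proof.
apply/le_anti/andP; split; last by rewrite leUx !co_under_le // (leUl, leUr).
apply: co_leP => s; rewrite co_joinE => /=.
case sE : (node_word s) (nodeP s) => [|e s'] //=.
rewrite {1}/lies_under sE => /andP[/asboolP re es] sab; set l := last e s' in sab.
have [jl pl] := path_oriented (root_oriented re) es.
have self c : label l <= c -> co_set (co_under c) s by rewrite /= /lies_under sE.
case: (pselect (label l <= a)) => [/self sa|nla].
  by split; left; exists s.
case: (pselect (label l <= b)) => [/self sb|nlb].
  by split; right; exists s.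
have [x [y [xa yb c]]] := cover_exists MS minimal_left jl sab nla nlb.
have [bx [tx [bxE txa sx]]] := cover_child sE c.
have [by_ [ty [byE tyb sy]]] := cover_child sE (cover_sym c).
have nb : bx != by_.
  apply/eqP => bxy; rewrite -bxy in byE.
  have [Kx|Ky] := pl.1 _ _ c.
    by apply: (polarity_cover pl c Kx); apply/byE/bxE.
  by apply: (polarity_cover pl (cover_sym c) Ky); apply/bxE/byE.
have {}txa := txa _ xa; have {}tyb := tyb _ yb.
case: bx by_ nb sx sy {bxE byE} => [] [] // _ sx sy.
  by split; [right; exists ty|left; exists tx].
by split; [left; exists tx|right; exists ty].
Qed.

Lemma root_node p : ji p ->
  exists s : node, forall a, lies_under a s <-> p <= a.
Proof.
move=> jp.
have [r rP] : exists r, (exists s, mincover p r s) \/ (forall x y, ~ mincover p x y).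
  case: (pselect (exists r s, mincover p r s)) => [[r prs]|nc]; first by exists r; left.
  by exists p; right=> x y c; apply: nc; exists x, y.
have vs : valid [:: (r, p, r, true)] by rewrite /= andbT; apply/asboolP; split.
by exists (Node vs).
Qed.

(** A longer chain would lie on a path with halves of total length at least
    [n + 1].  By (H_n) each half is shorter than [n]; hence both have at least
    two edges, and truncating one of them leaves opposite tracks of lengths
    [k] and [n + 1 - k] with [1 < k < n]. *)
Lemma node_length n : (0 < n)%N ->
  (forall e, e \in SUB_identities n -> satisfies M e) -> length_at_most n node.
Proof.
move=> n0 Mn; have Hn : satisfies M (idH n).
  by apply: Mn; rewrite mem_cat !inE eqxx !orbT.
have short e b (s : word (M * M * M)%type) :
      path step e s -> signed b s -> (size s < n)%N.
  move=> es bs; rewrite ltnNge; apply/negP => ns.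
  apply: (idH_track MS MU n0 Hn (track_leq ns (path_track es bs))).
move=> c uc cc.
have [||c0|] := @chain_size _ (map node_word c).
- by rewrite map_inj_uniq //; exact: val_inj.
- by move=> _ _ /mapP[s sc ->] /mapP[t tc ->]; exact: cc.
- by case: c c0 {uc cc}.
case=> _ [_ [g [s' [t' [/mapP[s _ ->] /mapP[t _ ->] [sE tE] [ns' pt']]]]]].
rewrite size_map => /leq_trans; apply.
have [e [g' [_ oe es et _]]] := node_split sE tE ns'.
set l := last e g' in oe es et.
have [sn tn] := (short _ _ _ es ns', short _ _ _ et pt').
rewrite leqNgt; apply/negP => big.
pose k := size s'; pose m := (n + 1 - k)%N.
have k1 : (1 < k)%N by rewrite /k; lia.
have kn : (k < n)%N by [].
have Hk : satisfies M (idH2 k m).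
  apply: Mn; rewrite mem_cat; apply/orP; right.
  by apply: (map_f (fun k => idH2 k (n + 1 - k))); rewrite mem_index_iota k1.
have trs := path_track es ns'.
have m0 : (0 < m)%N by rewrite /m /k; lia.
have mt : (m <= size t')%N by rewrite /m /k; lia.
have trt := track_leq mt (path_track et pt').
apply: (idH2_tracks MS MU (ltnW k1) m0 Hk trs trt) => //.
by apply: (signed_paths_heads oe es et ns' pt'); [exact: ltnW|exact: leq_trans mt].
Qed.

End Tree.

(** * The representation theorem *)
Section Embedding.
Local Open Scope order_scope.

Lemma lattice_morphism d (L : latticeType d) d' (K : latticeType d') (f : L -> K) :
  {morph f : a b / a `&` b} -> {morph f : a b / a `|` b} ->
  exists g : {lmorphism L -> K}, g =1 f.
Proof.
move=> fI fU; have f_homo : {homo f : a b / a <= b}.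
  by move=> a b ab; rewrite -(join_r ab) fU leUl.
pose fo := Order.isOrderMorphism.Build _ _ _ _ f f_homo.
pose fm := Order.isMeetLatticeMorphism.Build _ _ _ _ f fI.
pose fj := Order.isJoinLatticeMorphism.Build _ _ _ _ f fU.
pose g : {lmorphism L -> K} := HB.pack f fo fm fj.
by exists g.
Qed.

Variables (d : Order.disp_t) (L : latticeType d).
Implicit Types (F G : lfilter L).

(** [F <= Y \/ H] says that [Y] avoids [H] minus [F]. *)
Lemma filter_minimal_joinands : minimal_joinands (lfilter L).
Proof.
move=> F G H.
have leE Y : F <= Y `|` H <-> forall a, fset Y a -> ~ (fset H a /\ ~ fset F a).
  split=> [/filter_leP FYH a Ya [Ha nFa]|YF]; first by apply/nFa/FYH/fset_joinE.
  apply/filter_leP => a /fset_joinE[Ya Ha]; apply: contrapT => nFa.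
  exact: YF Ya (conj Ha nFa).
case/leE/filter_avoiding=> X [XG XF Xmin]; exists X; split=> //; first exact/leE.
by move=> Y YX /leE; exact: Xmin.
Qed.

(** A filter maximal among those without [a] is join-irreducible: two filters
    with intersection [P] cannot both contain [a], and the one without [a] is
    [P] by maximality. *)
Lemma filter_ji_separation F G : ~ F <= G ->
  exists P : lfilter L, [/\ ji P, P <= F & ~ P <= G].
Proof.
move=> nFG; have [a Ga nFa] : exists2 a, fset G a & ~ fset F a.
  apply: contrapT => nex; apply: nFG; apply/filter_leP => a Ga.
  by apply: contrapT => nFa; apply: nex; exists a.
have [|P [PF Pa Pmin]] := @filter_avoiding _ _ F (fun c => c = a).
  by move=> c Fc ca; apply: nFa; rewrite -ca.
exists P; split=> //; last by move/filter_leP => /(_ _ Ga) /Pa; exact.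
move=> G1 G2 PE; have nP : ~ (fset G1 a /\ fset G2 a).
  by move=> [G1a G2a]; apply: (Pa a) => //; rewrite PE; apply/fset_joinE.
have minE Q : Q <= P -> ~ fset Q a -> P = Q.
  by move=> QP nQa; apply/esym/Pmin => // c Qc ca; apply: nQa; rewrite -ca.
case: (pselect (fset G1 a)) => [G1a|nG1a].
  by right; apply: minE; [rewrite PE leUr|move=> G2a; exact: nP].
by left; apply: minE => //; rewrite PE leUl.
Qed.

Lemma satisfies_SUB n : (0 < n)%N ->
  (forall e, e \in SUB_identities n -> satisfies L e) -> SUB n L.
Proof.
move=> n0 Ln; pose M : latticeType _ := lfilter L.
have Mn e : e \in SUB_identities n -> satisfies M e.
  by move=> /Ln; exact: filter_satisfies.
have MS : satisfies M idS by apply: Mn; rewrite mem_cat !inE eqxx.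
have MU : satisfies M idU by apply: Mn; rewrite mem_cat !inE eqxx !orbT.
have MB : satisfies M idB by apply: Mn; rewrite mem_cat !inE eqxx !orbT.
have Mmin := @filter_minimal_joinands : minimal_joinands M.
pose f (a : L) : Co (node M) := co_under MS MU MB Mmin (principal a).
have fI : {morph f : a b / a `&` b} by move=> a b; rewrite /f principalI co_underI.
have fU : {morph f : a b / a `|` b} by move=> a b; rewrite /f principalU co_underU.
have [g gE] := lattice_morphism fI fU.
have Pn : length_at_most n (node M) by exact: node_length.
have le_f a b : f a = f b -> a <= b.
  move=> fab; apply: contrapT => nab.
  have [|P [jP Pa nPb]] := @filter_ji_separation (principal a) (principal b).
    by move/le_principal.
  have [s sE] := root_node jP.
  by apply/nPb/sE; rewrite -[lies_under _ s]/(co_set (f b) s) -fab; apply/sE.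
exists node_display, (node M), g; split=> // a b; rewrite !gE => fab.
by apply/le_anti/andP; split; apply: le_f.
Qed.

End Embedding.

Theorem corollary6p5 (n : nat) (hn : 0 < n) :
  finitely_based_variety (SUB n) /\ defined_by (SUB n) (SUB_identities n).
Proof.
suff def : defined_by (SUB n) (SUB_identities n).
  by split=> //; exists (SUB_identities n).
move=> d L; split=> [SL e|]; first exact: SUB_satisfies.
exact: satisfies_SUB.
Qed.
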